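(* Let $r\geq 3$ and $n\geq 4r+8$ be integers. Then $\sigma(K_{r+1}-P_2,n)=(r-1)(2n-r)-2(n-r)+2$.
   Context: A sequence $\pi=(d_1,\dots,d_n)$ of non-increasing nonnegative integers is graphic if it is the degree sequence of a simple graph on $n$ vertices (a realization of $\pi$); $\sigma(\pi)=d_1+\cdots+d_n$. For a graph $F$, a graphic sequence $\pi$ is potentially $F$-graphical if some realization of $\pi$ contains $F$ as a subgraph. $\sigma(F,n)$ denotes the minimum even integer $l$ such that every $n$-term graphic sequence $\pi$ with $\sigma(\pi)\geq l$ is potentially $F$-graphical. $P_2$ denotes the path on $3$ vertices (with $2$ edges). For a subgraph $H$ of $K_m$, $K_m-H$ is the graph obtained from the complete graph $K_m$ by deleting the edges of $H$. *)

(* Defs.v *)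
From mathcomp Require Import all_boot.
From mathcomp Require Import boolp.

Set Implicit Arguments.
Unset Strict Implicit.
Unset Printing Implicit Defensive.

Record sgraph (V : finType) := SGraph {
  adj :> rel V;
  adj_sym : symmetric adj;
  adj_irr : irreflexive adj
}.

Definition deg (V : finType) (G : sgraph V) (v : V) : nat :=
  #|[set w | G v w]|.

(* [F] need not be an induced subgraph of [G]. *)
Definition contains (U V : finType) (F : sgraph U) (G : sgraph V) : Prop :=
  exists2 f : U -> V, injective f & forall x y, F x y -> G (f x) (f y).

(* The degree sequence is taken up to reordering, so the labelling of the
   vertices by 'I_n is irrelevant. *)
Definition realization (n : nat) (G : sgraph 'I_n) (s : n.-tuple nat) : Prop :=
  perm_eq [seq deg G v | v : 'I_n] s.

Definition graphic (n : nat) (s : n.-tuple nat) : Prop :=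
  sorted geq s /\ exists G : sgraph 'I_n, realization G s.

Definition potentially (U : finType) (F : sgraph U) (n : nat)
    (s : n.-tuple nat) : Prop :=
  exists2 G : sgraph 'I_n, realization G s & contains F G.

Definition sigma_bound (U : finType) (F : sgraph U) (n l : nat) : Prop :=
  ~~ odd l /\
  forall s : n.-tuple nat, graphic s -> l <= sumn s -> potentially F s.

Lemma sigma_bound_exists (U : finType) (F : sgraph U) (n : nat) :
  exists l, `[< sigma_bound F n l >].
Proof.
exists (n * n).+1.*2; apply/asboolP; split; first by rewrite odd_double.
move=> s [_ [G Gs]]; rewrite -(perm_sumn Gs) sumnE big_map big_enum /=.
have le_nn : \sum_(v : 'I_n) deg G v <= n * n.
  rewrite -[leqRHS](_ : \sum_(v < n) n = _); last by rewrite sum_nat_const card_ord.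
  by apply: leq_sum => v _; rewrite -[leqRHS]card_ord max_card.
move=> /leq_trans /(_ le_nn); rewrite -addnn leqNgt.
by rewrite (leq_trans (ltnSn _) (leq_addr _ _)).
Qed.

(* Restricting the minimum to l >= 0 loses nothing when [F] has an edge: then
   the zero sequence shows that no l <= 0 has the required property. *)
Definition sigma (U : finType) (F : sgraph U) (n : nat) : nat :=
  ex_minn (sigma_bound_exists F n).

(* K_m - H, where vertex i of [H] is identified with vertex i of K_m. Up to
   isomorphism the result does not depend on the position of [H] in K_m; it
   has the intended meaning for k <= m. *)
Section CompleteMinus.
Variables (m k : nat) (H : sgraph 'I_k).

Definition complete_minus_rel : rel 'I_m := fun x y =>
  (x != y) &&
  ~~ [exists a : 'I_k, exists b : 'I_k,
        [&& val a == val x, val b == val y & H a b]].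

Fact complete_minus_sym : symmetric complete_minus_rel.
Proof.
have imp x y : complete_minus_rel x y -> complete_minus_rel y x.
  rewrite /complete_minus_rel eq_sym => /andP[-> /=]; apply: contra.
  case/existsP=> a /existsP[b /and3P[ay bx Hab]].
  by apply/existsP; exists b; apply/existsP; exists a; rewrite ay bx adj_sym.
by move=> x y; apply/idP/idP; apply: imp.
Qed.

Fact complete_minus_irr : irreflexive complete_minus_rel.
Proof. by move=> x; rewrite /complete_minus_rel eqxx. Qed.

Definition complete_minus : sgraph 'I_m :=
  SGraph complete_minus_sym complete_minus_irr.
End CompleteMinus.

(* Indexed by the number of edges: [path_graph k] has k + 1 vertices. *)
Section PathGraph.
Variable k : nat.

Definition path_rel : rel 'I_k.+1 := fun x y =>
  (x.+1 == y :> nat) || (y.+1 == x :> nat).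

Fact path_sym : symmetric path_rel.
Proof. by move=> x y; rewrite /path_rel orbC. Qed.

Fact path_irr : irreflexive path_rel.
Proof. by move=> x; rewrite /path_rel orbb gtn_eqF. Qed.

Definition path_graph : sgraph 'I_k.+1 := SGraph path_sym path_irr.
End PathGraph.

(* Main.v *)
(* Put [k = r - 2], so that the graph to be found is the join of a clique on a
   set [W] of [k] vertices with an edge [ab] and a vertex [c].

   Upper bound, by induction on [k].  If all degrees are at most [2k + 2], the
   graph is obtained on [k + 3] vertices of large degree by switchings along
   alternating closed trails of length 4 and 6: when no switching helps, the
   edges outside the wanted ones are covered by two small sets, and there are
   too few of them.  If a vertex [v] has degree at least [2k + 3], let its
   neighbours have the largest possible degrees, delete [v], and take by
   induction the graph for [k - 1] in a realization of the rest, meeting the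
   neighbourhood of [v] as much as possible.  If it is not contained in the
   neighbourhood, switchings show that the neighbours of [v] outside it form a
   clique with [k + 3] vertices together with [v], or else produce the graph in
   a tight case where a missed vertex has degree [k + 1].

   Lower bound: in every realization of the degree sequence of the join of
   [K_{k-1}] with a cycle, only [k - 1] vertices have degree at least [k + 2],
   while [k] of them are needed. *)

Require Import Defs.
From mathcomp Require Import all_boot all_order all_algebra.
From mathcomp Require Import boolp perm zify.
Import GRing.Theory.

Set Implicit Arguments.
Unset Strict Implicit.
Unset Printing Implicit Defensive.

(** * Degree-preserving switchings *)

Section Switching.
Variable V : finType.
Implicit Types (G H : sgraph V) (a b s t u v w x y z : V) (P : rel V).

Definition nbr G v := [set w | G v w].

Definition same_deg G H := forall v, deg H v = deg G v.

Lemma same_deg_trans G H K : same_deg G H -> same_deg H K -> same_deg G K.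
Proof. by move=> GH HK v; rewrite HK. Qed.

(** Equality of unordered pairs, so that one boolean describes an edge in both directions. *)
Definition upair a b x y := (a == x) && (b == y) || (a == y) && (b == x).

Lemma upairC a b x y : upair a b x y = upair b a x y.
Proof. by rewrite /upair orbC andbC [in X in _ || X]andbC. Qed.

Lemma upairxx a b : upair a b a b.
Proof. by rewrite /upair !eqxx. Qed.

Lemma adj_neq G x y : G x y -> x != y.
Proof. by apply: contraTneq => ->; rewrite adj_irr. Qed.

Fact del_sym G x y : symmetric (fun a b => G a b && ~~ upair a b x y).
Proof. by move=> a b; rewrite adj_sym upairC. Qed.
Fact del_irr G x y : irreflexive (fun a b => G a b && ~~ upair a b x y).
Proof. by move=> a; rewrite adj_irr. Qed.
Definition del G x y := SGraph (@del_sym G x y) (@del_irr G x y).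

Fact add_sym G x y : symmetric (fun a b => G a b || (a != b) && upair a b x y).
Proof. by move=> a b; rewrite adj_sym upairC eq_sym. Qed.
Fact add_irr G x y : irreflexive (fun a b => G a b || (a != b) && upair a b x y).
Proof. by move=> a; rewrite adj_irr eqxx. Qed.
Definition add G x y := SGraph (@add_sym G x y) (@add_irr G x y).

Lemma addE G x y a b : x != y -> add G x y a b = G a b || upair a b x y.
Proof.
move=> xy; congr (_ || _); rewrite andb_idl //.
by case/orP=> /andP[/eqP-> /eqP->]; rewrite // eq_sym.
Qed.

Lemma deg_del G x y v : G x y -> deg G v = deg (del G x y) v + (v == x) + (v == y).
Proof.
move=> Gxy; have xy := adj_neq Gxy.
have notin p q : p != q -> (v == p) = true -> (v == q) = false.
  by move=> pq /eqP->; apply/negbTE.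
have [vx|vx] := boolP (v == x).
  rewrite (notin _ _ xy vx) addn0 addn1 (eqP vx) /deg.
  rewrite (_ : [set w | G x w] = y |: [set w | del G x y x w]).
    by rewrite cardsU1 inE /= /upair !eqxx /= andbF.
  apply/setP=> w; rewrite !inE /= /upair eqxx (negbTE xy) /= orbF.
  by case: eqVneq => [->|_]; rewrite ?Gxy ?andbT.
have [vy|vy] := boolP (v == y).
  rewrite addn0 addn1 (eqP vy) /deg.
  rewrite (_ : [set w | G y w] = x |: [set w | del G x y y w]).
    by rewrite cardsU1 inE /= /upair !eqxx /= orbT andbF.
  apply/setP=> w; rewrite !inE /= /upair eqxx [y == x]eq_sym (negbTE xy) /=.
  by case: eqVneq => [->|_]; rewrite ?andbT // adj_sym.
rewrite !addn0; congr #|pred_of_set _|; apply/setP=> w; rewrite !inE /= /upair.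
by rewrite (negbTE vx) (negbTE vy) andbT.
Qed.

Lemma deg_add G x y v : x != y -> ~~ G x y ->
  deg (add G x y) v = deg G v + (v == x) + (v == y).
Proof.
move=> xy nGxy.
have Axy : add G x y x y by rewrite addE // upairxx orbT.
rewrite (deg_del v Axy); congr (_ + _ + _); congr #|pred_of_set _|.
apply/setP=> w; rewrite !inE /= -/(add G x y v w).
have [vw|vw] := boolP (upair v w x y); last by rewrite andbF orbF andbT.
rewrite andbF; apply/esym/negbTE; move: vw nGxy.
by case/orP=> /andP[/eqP-> /eqP->] //; rewrite adj_sym.
Qed.

Lemma del_edge G x y : G x y ->
  exists2 H : sgraph V, (forall v, deg G v = deg H v + (v == x) + (v == y)) &
    forall a b, H a b = G a b && ~~ upair a b x y.
Proof. by move=> xy; exists (del G x y) => // v; apply: deg_del. Qed.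

Lemma add_edge G x y : x != y -> ~~ G x y ->
  exists2 H : sgraph V, (forall v, deg H v = deg G v + (v == x) + (v == y)) &
    forall a b, H a b = G a b || upair a b x y.
Proof.
by move=> xy nxy; exists (add G x y) => [v|a b]; [apply: deg_add | apply: addE].
Qed.

(** The closed trail [u v y x] alternates between non-edges and edges, so toggling it keeps all
    degrees. The distinctness [x != v] and [y != u] comes from [u] and [v] being non-adjacent. *)
Lemma switch2 G u x v y :
  u != v -> ~~ G u v -> x != y -> ~~ G x y -> G u x -> G v y ->
  exists2 H, same_deg G H &
    forall a b, H a b = [|| [&& G a b, ~~ upair a b u x & ~~ upair a b v y],
                         upair a b u v | upair a b x y].
Proof.
move=> uv nuv xy nxy ux vy.
have ux' := adj_neq ux; have vy' := adj_neq vy.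
have xv : x != v by apply: contraNneq nuv => <-.
have yu : y != u by apply: contraNneq nuv => <-; rewrite adj_sym.
have [G1 d1 E1] := del_edge ux.
have [|G2 d2 E2] := @del_edge G1 v y.
  by rewrite E1 vy /upair [v == u]eq_sym [v == x]eq_sym (negbTE uv) (negbTE xv).
have [|G3 d3 E3] := @add_edge G2 u v uv; first by rewrite E2 E1 (negbTE nuv).
have [|G4 d4 E4] := @add_edge G3 x y xy.
  by rewrite E3 E2 E1 (negbTE nxy) /upair [x == u]eq_sym (negbTE ux') (negbTE xv).
exists G4 => [w|a b]; last by rewrite E4 E3 E2 E1 -!andbA -!orbA.
by move: (d1 w) (d2 w) (d3 w) (d4 w); clear; lia.
Qed.

(** The toggled closed trail is [u v y w z x]; its vertices may repeat, for instance [x = y]. The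
    relation assumed between [x] and [y] yields [y != z], so that the toggled pairs are distinct. *)
Lemma switch3 G u x v y z w :
  u != v -> ~~ G u v -> (x == y) || G x y ->
  x != z -> ~~ G x z -> y != w -> ~~ G y w -> G u x -> G v y -> G z w ->
  exists2 H, same_deg G H &
    forall a b, H a b =
      [|| [&& G a b, ~~ upair a b u x, ~~ upair a b v y & ~~ upair a b z w],
          upair a b u v, upair a b x z | upair a b y w].
Proof.
move=> uv nuv xy xz nxz yw nyw ux vy zw.
have ux' := adj_neq ux; have vy' := adj_neq vy; have zw' := adj_neq zw.
have xv : x != v by apply: contraNneq nuv => <-.
have yu : y != u by apply: contraNneq nuv => <-; rewrite adj_sym.
have zu : z != u by apply: contraNneq nxz => ->; rewrite adj_sym.
have yz : y != z.
  by apply: contraTneq xy => ->; rewrite negb_or xz.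
have [G1 d1 E1] := del_edge ux.
have [|G2 d2 E2] := @del_edge G1 v y.
  by rewrite E1 vy /upair [v == u]eq_sym [v == x]eq_sym (negbTE uv) (negbTE xv).
have [|G3 d3 E3] := @del_edge G2 z w.
  rewrite E2 E1 zw /upair (negbTE zu) [z == x]eq_sym (negbTE xz).
  by rewrite [w == y]eq_sym (negbTE yw) [z == y]eq_sym (negbTE yz) !andbF.
have [|G4 d4 E4] := @add_edge G3 u v uv; first by rewrite E3 E2 E1 (negbTE nuv).
have [|G5 d5 E5] := @add_edge G4 x z xz.
  by rewrite E4 E3 E2 E1 (negbTE nxz) /upair [x == u]eq_sym (negbTE ux') (negbTE xv).
have [|G6 d6 E6] := @add_edge G5 y w yw.
  rewrite E5 E4 E3 E2 E1 (negbTE nyw) /upair (negbTE yu) [y == v]eq_sym (negbTE vy').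
  by rewrite (negbTE yz) [w == z]eq_sym (negbTE zw') !andbF.
exists G6 => [t|a b]; last by rewrite E6 E5 E4 E3 E2 E1 -!andbA -!orbA.
by move: (d1 t) (d2 t) (d3 t) (d4 t) (d5 t) (d6 t); clear; lia.
Qed.

End Switching.

(** Serves the extremal choices below, which range over graphs under propositional conditions: the
    set of attained values is made boolean classically, and a bound gives it a maximum. *)
Lemma exists_maximal (T : Type) (Q : T -> Prop) (w : T -> nat) B (i0 : T) :
  Q i0 -> (forall x, Q x -> w x <= B) ->
  exists2 x, Q x & forall y, Q y -> w y <= w x.
Proof.
move=> Q0 QB; pose attained m := `[< exists2 x, Q x & w x = m >].
have ex : exists m, attained m by exists (w i0); apply/asboolP; exists i0.
have ub m : attained m -> m <= B by case/asboolP => x Qx <-; apply: QB.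
case: (ex_maxnP ex ub) => m /asboolP[x Qx wx] max; exists x => // y Qy.
by rewrite wx max //; apply/asboolP; exists y.
Qed.

(** * Exchanging the roles of two vertices without changing degrees *)

Section DegreePreserving.
Variable V : finType.
Implicit Types (G H : sgraph V) (a b s t u v w x y z : V) (P : rel V).

(** Otherwise, leaving the pair [s], [t] aside, [t] sees every neighbour of [s] and also [v], and so
    has the larger degree. *)
Lemma extra_neighbour G s t v :
  G t v -> ~~ G s v -> v != s -> deg G t <= deg G s ->
  exists q, [/\ G s q, ~~ G t q, q != t & q != v].
Proof.
move=> tv sv vs; rewrite leqNgt; apply: contraNP => nex.
have sub : nbr G s :\ t \subset (nbr G t :\ s) :\ v.
  apply/subsetP=> q; rewrite !inE => /andP[qt sq].
  have qv : q != v by apply: contraNneq sv => <-.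
  rewrite qv [q == s]eq_sym (adj_neq sq) /=.
  by apply: contrapT => ntq; apply: nex; exists q; split=> //; apply/negP.
have := subset_leq_card sub; rewrite /deg -!/(nbr _ _).
have := cardsD1 t (nbr G s); have := cardsD1 s (nbr G t).
have := cardsD1 v (nbr G t :\ s); rewrite !inE vs tv [G s t]adj_sym.
move: #|nbr G s| #|nbr G t| #|nbr G s :\ t| #|nbr G t :\ s| => c1 c2 c3 c4.
by move: #|_| => c5; clear; lia.
Qed.

Lemma subset_of_card (A : {set V}) n :
  n <= #|A| -> exists2 B : {set V}, B \subset A & #|B| = n.
Proof.
move=> nA; exists [set x in take n (enum A)].
  by apply/subsetP=> x; rewrite inE => /mem_take; rewrite mem_enum.
rewrite cardsE; have /card_uniqP-> : uniq (take n (enum A)) by rewrite take_uniq ?enum_uniq.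
by rewrite size_takel // -cardE.
Qed.

(* Interchanges the adjacencies of [s] and [t] to the vertices of [D]. *)
Section Exchange.
Variables (G : sgraph V) (s t : V) (D : {set V}).
Hypotheses (sD : s \notin D) (tD : t \notin D).

Let flip a b := if b \in D then tperm s t a else a.

Fact exchange_sym : symmetric (fun a b => G (flip a b) (flip b a)).
Proof. by move=> a b; rewrite adj_sym. Qed.
Fact exchange_irr : irreflexive (fun a b => G (flip a b) (flip b a)).
Proof. by move=> a; rewrite adj_irr. Qed.
Definition exchange := SGraph exchange_sym exchange_irr.

Lemma exchange_left b : exchange s b = if b \in D then G t b else G s b.
Proof.
by rewrite /= /flip (negbTE sD) tpermL; case: ifP.
Qed.

Lemma exchange_right b : exchange t b = if b \in D then G s b else G t b.
Proof.
by rewrite /= /flip (negbTE tD) tpermR; case: ifP.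
Qed.

Lemma exchange_out a b :
  a != s -> a != t -> b != s -> b != t -> exchange a b = G a b.
Proof.
move=> as_ at_ bs bt; rewrite /= /flip.
by rewrite !tpermD 1?eq_sym // !if_same.
Qed.

Lemma exchange_deg :
  #|nbr G s :&: D| = #|nbr G t :&: D| -> same_deg G exchange.
Proof.
move=> eqD v; rewrite /deg -!/(nbr _ _).
have [->|vs] := eqVneq v s.
  rewrite -(cardsID D (nbr exchange s)) -(cardsID D (nbr G s)) eqD.
  by congr (_ + _); apply: eq_card => b; rewrite !inE exchange_left; case: (b \in D);
     rewrite ?andbF ?andbT.
have [->|vt] := eqVneq v t.
  rewrite -(cardsID D (nbr exchange t)) -(cardsID D (nbr G t)) -eqD.
  by congr (_ + _); apply: eq_card => b; rewrite !inE exchange_right; case: (b \in D);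
     rewrite ?andbF ?andbT.
have flipv b : flip v b = v by rewrite /flip tpermD 1?eq_sym // if_same.
have [vD|vD] := boolP (v \in D); last first.
  by apply: eq_card => b; rewrite !inE /= flipv /flip (negbTE vD).
rewrite -(card_imset (mem (nbr G v)) (@perm_inj _ (tperm s t))).
apply: eq_card => b; rewrite inE /= flipv /flip vD.
by rewrite -[b in RHS](tpermK s t) mem_imset ?inE //; apply: perm_inj.
Qed.

End Exchange.

(** Let [M] be the [P]-neighbours of [s] that [t] misses. Since [deg G s <= deg G t], as many
    vertices [N'] are seen by [t] and missed by [s]; exchanging the adjacencies to [M] and [N'] lets
    [t] replace [s]. By domination [s] keeps what it needs to replace [t]. *)
Lemma exchange_embedding G P s t :
    symmetric P -> irreflexive P -> (forall x y, P x y -> G x y) ->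
    s != t -> deg G s <= deg G t ->
    (forall y, P t y -> y != s -> P s y) ->
  exists2 H, same_deg G H & forall x y, P x y -> H (tperm s t x) (tperm s t y).
Proof.
move=> Psym Pirr PG st dst dom.
pose M := [set f | [&& P s f, ~~ G t f & f != t]].
pose N := [set q | [&& G t q, ~~ G s q & q != s]].
have leMN : #|M| <= #|N|.
  have eI : (nbr G s :\ t) :&: nbr G t = (nbr G t :\ s) :&: nbr G s.
    apply/setP=> f; rewrite !inE.
    have [->|_] := eqVneq f t; first by rewrite adj_irr !andbF.
    by have [->|_] := eqVneq f s; [rewrite adj_irr andbF | apply: andbC].
  have sub : M \subset (nbr G s :\ t) :\: nbr G t.
    by apply/subsetP=> f; rewrite !inE => /and3P[/PG-> -> ->].
  have eN : N = (nbr G t :\ s) :\: nbr G s.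
    by apply/setP=> f; rewrite !inE andbC andbA.
  have := subset_leq_card sub; rewrite eN; move: dst; rewrite /deg -!/(nbr _ _).
  have := cardsID (nbr G t) (nbr G s :\ t); have := cardsID (nbr G s) (nbr G t :\ s).
  rewrite -eI; have := cardsD1 t (nbr G s); have := cardsD1 s (nbr G t).
  rewrite !inE [G s t]adj_sym.
  move: #|nbr G s| #|nbr G t| #|nbr G s :\ t| #|nbr G t :\ s| => c1 c2 c3 c4.
  by move: #|_| #|_| #|_| #|_| => c5 c6 c7 c8; clear; lia.
have [N' sN' cN'] := subset_of_card leMN.
pose D : {set V} := M :|: N'.
have inN' q : q \in N' -> [/\ G t q, ~~ G s q & q != s].
  by move/(subsetP sN'); rewrite inE => /and3P[].
have sD : s \notin D.
  rewrite !inE Pirr /=; apply/negP=> /inN'[]; by rewrite eqxx.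
have tD : t \notin D.
  rewrite !inE eqxx !andbF /=; apply/negP=> /inN'[]; by rewrite adj_irr.
have eMs : nbr G s :&: D = M.
  apply/setP=> f; rewrite !inE; apply/andP/idP => [[sf /orP[//|/inN'[_]]]|].
    by rewrite sf.
  by move=> Mf; rewrite Mf; case/and3P: Mf => /PG.
have eNt : nbr G t :&: D = N'.
  apply/setP=> f; rewrite !inE; apply/andP/idP => [[tf /orP[/and3P[_]|//]]|Nf].
    by rewrite tf.
  by rewrite Nf orbT; case/inN': Nf.
exists (exchange G s t D); first by apply: exchange_deg => //; rewrite eMs eNt cN'.
have main x y : x \in [set s; t] -> P x y -> exchange G s t D (tperm s t x) (tperm s t y).
  rewrite !inE => /orP[] /eqP-> Pxy.
    have [yt|yt] := eqVneq y t.
      by rewrite yt tpermL tpermR exchange_right // (ifN _ _ sD) adj_sym PG // -yt.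
    have ys : y != s by apply: contraTneq Pxy => ->; rewrite Pirr.
    rewrite tpermL tpermD 1?eq_sym // exchange_right //; case: ifPn => [_|]; first exact: PG.
    by rewrite !inE Pxy yt /= andbT negb_or negbK => /andP[].
  have [ys|ys] := eqVneq y s.
    by rewrite ys tpermL tpermR exchange_left // (ifN _ _ tD) adj_sym PG // -ys.
  have yt : y != t by apply: contraTneq Pxy => ->; rewrite Pirr.
  rewrite tpermR tpermD 1?eq_sym // exchange_left //; case: ifP => _; apply: PG => //.
  exact: dom.
move=> x y Pxy; have [|] := boolP (x \in [set s; t]); first by move/main; apply.
have [yst _|] := boolP (y \in [set s; t]); first by rewrite adj_sym main // Psym.
rewrite !inE !negb_or => /andP[ys yt] /andP[xs xt].
by rewrite !tpermD 1?eq_sym // exchange_out // PG.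
Qed.

(** * Deleting a vertex and putting it back *)

Section Star.
Variables (G : sgraph V) (v : V) (N : {set V}).
Hypothesis vN : v \notin N.

Fact isolate_sym : symmetric (fun a b => [&& a != v, b != v & G a b]).
Proof. by move=> a b; rewrite adj_sym andbCA. Qed.
Fact isolate_irr : irreflexive (fun a b => [&& a != v, b != v & G a b]).
Proof. by move=> a; rewrite adj_irr !andbF. Qed.
(** A deleted vertex stays in the type as an isolated one; hence the sets [U] below, outside which
    all degrees vanish. *)
Definition isolate := SGraph isolate_sym isolate_irr.

Let star a b :=
  if a == v then b \in N else if b == v then a \in N else G a b.

Fact star_sym : symmetric star.
Proof.
by move=> a b; rewrite /star adj_sym; case: (eqVneq a v) => [->|_]; case: (eqVneq b v) => // ->.
Qed.
Fact star_irr : irreflexive star.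
Proof. by move=> a; rewrite /star adj_irr; case: eqVneq => [->|//]; apply/negbTE. Qed.
Definition star_at := SGraph star_sym star_irr.

Lemma deg_isolate_self : deg isolate v = 0.
Proof. by apply/eqP; rewrite cards_eq0; apply/eqP/setP=> w; rewrite !inE /= eqxx. Qed.

Lemma deg_isolate w : w != v -> deg G w = deg isolate w + G w v.
Proof.
move=> wv; rewrite /deg addnC (cardsD1 v) inE; congr (_ + _).
by apply: eq_card => x; rewrite !inE /= wv.
Qed.

Lemma nbr_star : nbr star_at v = N.
Proof. by apply/setP=> w; rewrite inE /= /star eqxx. Qed.

Lemma star_out a b : a != v -> b != v -> star_at a b = G a b.
Proof. by move=> av bv; rewrite /= /star (negbTE av) (negbTE bv). Qed.

Lemma star_self b : star_at v b = (b \in N).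
Proof. by rewrite /= /star eqxx. Qed.

End Star.

(** In [H] the vertex [v] has degree 0, as in [isolate G v], so joining it to its old neighbours
    restores every degree. *)
Lemma same_deg_star G H v (vN : v \notin nbr G v) :
  same_deg (isolate G v) H -> same_deg G (star_at H vN).
Proof.
move=> dH w; have [->|wv] := eqVneq w v.
  by rewrite /deg -/(nbr _ _) nbr_star.
have Hv x : H x v = false.
  apply/negbTE/negP; rewrite adj_sym => Hx; have := dH v; rewrite deg_isolate_self.
  by move/eqP; rewrite cards_eq0 => /eqP/setP/(_ x); rewrite !inE Hx.
rewrite (deg_isolate G wv) (deg_isolate (star_at H vN) wv) -dH; congr (_ + _).
  apply: eq_card => x; rewrite !inE /= (negbTE wv) /=.
  by case: eqVneq => [->|_] //=; rewrite Hv.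
by rewrite adj_sym star_self inE adj_sym.
Qed.

(* Havel--Hakimi *)
Lemma top_neighbours G v :
  exists2 H, same_deg G H &
    forall p q, H v p -> ~~ H v q -> q != v -> deg G q <= deg G p.
Proof.
pose w H := \sum_(p in nbr H v) deg G p.
have [|H|H dH max] := @exists_maximal _ (same_deg G) w (\sum_p deg G p) G.
- by [].
- by move=> _; rewrite /w big_mkcond /=; apply: leq_sum => p _; case: ifP.
exists H => // p q vp vq qv; rewrite leqNgt; apply/negP=> lt_pq.
have pv : p != v by rewrite eq_sym (adj_neq vp).
(* As [q] has the larger degree, it has a neighbour [y] missed by [p]; replacing [vp] and [qy] by
   [vq] and [py] raises the weight. *)
have [||||y [qy py yp yv]] := @extra_neighbour H q p v; rewrite 1?adj_sym //.
- by rewrite eq_sym.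
- by rewrite !dH ltnW.
have pq : p != q by apply: contraNneq vq => <-.
have [||||||K dK EK] := @switch2 V H v p q y; rewrite // 1?eq_sym //.
have sub : q |: (nbr H v :\ p) \subset nbr K v.
  apply/subsetP=> z; rewrite !inE EK => /orP[/eqP->|/andP[zp vz]].
    by rewrite upairxx orbT.
  have zv : z != v by rewrite eq_sym (adj_neq vz).
  rewrite vz /upair (negbTE zp) (negbTE zv) !eqxx !andbF /=.
  by rewrite [v == q]eq_sym (negbTE qv) [v == y]eq_sym (negbTE yv).
have := max K (same_deg_trans dH dK); rewrite leqNgt => /negP; apply.
have -> : w H = deg G p + \sum_(z in nbr H v :\ p) deg G z.
  by rewrite /w (big_setD1 p) ?inE.
apply: (@leq_trans (\sum_(z in q |: (nbr H v :\ p)) deg G z)).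
  by rewrite big_setU1 ?ltn_add2r //= !inE negb_and vq orbT.
by rewrite [leqRHS](big_setID (q |: (nbr H v :\ p))) (setIidPr sub) leq_addr.
Qed.

End DegreePreserving.

(** * Realizing a threshold graph under bounded degrees *)

Section Threshold.
Variable V : finType.
Implicit Types (G H : sgraph V) (a b s t u v w x y z : V) (P : rel V) (A B C X : {set V}).

(** Both sides count the edges between [C] and its complement. *)
Lemma sum_nbr_exchange G C :
  \sum_(v in ~: C) #|nbr G v :&: C| = \sum_(c in C) #|nbr G c :\: C|.
Proof.
transitivity (\sum_(v in ~: C) \sum_(c in C) nat_of_bool (G v c)).
  apply: eq_bigr => v _; rewrite -sum1_card big_mkcond [RHS]big_mkcond /=.
  by apply: eq_bigr => c _; rewrite !inE andbC; case: (c \in C); case: (G v c).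
rewrite exchange_big; apply: eq_bigr => c _.
rewrite -sum1_card big_mkcond [RHS]big_mkcond /=; apply: eq_bigr => v _.
by rewrite !inE adj_sym; case: (v \in C); case: (G c v).
Qed.

Lemma sum_if_const C n : \sum_v (v \in C) * n = #|C| * n.
Proof.
rewrite -sum_nat_const [RHS]big_mkcond; apply: eq_bigr => v _.
by case: (v \in C); rewrite ?mul1n.
Qed.

(* With [C := A :&: B], the edges outside [P] meet [C] or lie inside [A :\: B]
   or inside [B :\: A]. *)
Lemma cover_bound G P A B X D xi :
    symmetric P -> (forall v, deg G v <= D) ->
    X \subset A :&: B ->
    (forall x c, x \in X -> c \in A :&: B -> c != x -> G x c) ->
    #|A| <= D.+1 -> #|B| <= D.+1 -> 0 < xi -> xi <= #|X| -> #|X| <= D ->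
    (forall z w, G z w -> ~~ P z w -> (z \in A) || (w \in B)) ->
  \sum_v deg G v + xi * (2 * D + 1 - xi) <=
    \sum_v #|[set w | P v w]| + 2 * (D * D.+1).
Proof.
move=> Psym degD sX XC leA leB xi0 xiX XD cover.
pose C := A :&: B; pose p := #|A :\: B|; pose q := #|B :\: A|.
have coverr z w : G z w -> ~~ P z w -> (w \in A) || (z \in B).
  by rewrite adj_sym Psym; apply: cover.
(* [f v] bounds the number of neighbours of [v] outside [P], by the position of [v] with respect to
   [A] and [B]. *)
pose f v := (v \in C) * deg G v + (v \in ~: C) * #|nbr G v :&: C|
            + (v \in A :\: B) * p.-1 + (v \in B :\: A) * q.-1.
have degf v : deg G v <= #|[set w | P v w]| + f v.
  rewrite /f; have [vC|vC] := boolP (v \in C).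
    by rewrite mul1n addnA -!addnA addnCA leq_addr.
  have -> : v \in ~: C by rewrite inE.
  rewrite mul0n mul1n add0n.
  have sub (E : {set V}) n : #|E| <= n ->
     (forall w, G v w -> ~~ P v w -> (w \in C) || (w \in E)) ->
     deg G v <= #|[set w | P v w]| + (#|nbr G v :&: C| + n).
    move=> En hE; apply: (@leq_trans #|[set w | P v w] :|: ((nbr G v :&: C) :|: E)|).
      apply/subset_leq_card/subsetP=> w; rewrite !inE => vw.
      have [//|nP] := boolP (P v w); rewrite vw /=.
      by move: (hE w vw nP); rewrite !inE.
    rewrite cardsU (leq_trans (leq_subr _ _)) // leq_add2l cardsU.
    by rewrite (leq_trans (leq_subr _ _)) // leq_add2l.
  move: vC; rewrite [v \in A :\: B]inE [v \in B :\: A]inE [v \in C]inE.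
  have [vA|vA] := boolP (v \in A); have [vB|vB] := boolP (v \in B) => //= _.
  - rewrite mul1n mul0n addn0.
    have vD : v \in A :\: B by rewrite inE vA vB.
    apply: (sub ((A :\: B) :\ v)); first by rewrite /p [in leqRHS](cardsD1 v) vD.
    move=> w vw nP; have := coverr _ _ vw nP; rewrite (negbTE vB) orbF !inE.
    by rewrite eq_sym (adj_neq vw) => ->; case: (w \in B).
  - rewrite mul1n mul0n addn0.
    have vD : v \in B :\: A by rewrite inE vA vB.
    apply: (sub ((B :\: A) :\ v)); first by rewrite /q [in leqRHS](cardsD1 v) vD.
    move=> w vw nP; have := cover _ _ vw nP; rewrite (negbTE vA) /= !inE.
    by rewrite eq_sym (adj_neq vw) => ->; case: (w \in A).
  - rewrite !mul0n !addn0 -[#|nbr G v :&: C|]addn0; apply: (sub set0); rewrite ?cards0 //.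
    move=> w vw nP; have := cover _ _ vw nP; have := coverr _ _ vw nP.
    by rewrite (negbTE vA) (negbTE vB) orbF !inE => -> /= ->.
have sumf : \sum_v f v = \sum_(c in C) (deg G c + #|nbr G c :\: C|) + p * p.-1 + q * q.-1.
  rewrite /f !big_split /= !sum_if_const -/p -/q; congr (_ + _ + _ + _).
    by rewrite [RHS]big_mkcond; apply: eq_bigr => v _; case: (v \in C); rewrite ?mul1n.
  rewrite -sum_nbr_exchange [RHS]big_mkcond; apply: eq_bigr => v _.
  by case: (v \in ~: C); rewrite ?mul1n.
have le1 : \sum_v deg G v <= \sum_v #|[set w | P v w]| + \sum_v f v.
  by rewrite -big_split; apply: leq_sum => v _.
have inner : #|X| * #|C|.-1 + (#|C| - #|X|) * #|X| <= \sum_(c in C) #|nbr G c :&: C|.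
  rewrite (big_setID X) (setIidPr sX) /=; apply: leq_add.
    rewrite -sum_nat_const; apply: leq_sum => x xX.
    have xC : x \in C by apply: (subsetP sX).
    rewrite (cardsD1 x) xC; apply/subset_leq_card/subsetP=> w.
    by rewrite !inE => /andP[wx /andP[wA wB]]; rewrite XC ?wA ?wB // inE wA wB.
  have -> : #|C| - #|X| = #|C :\: X| by rewrite cardsD (setIidPr sX).
  rewrite -sum_nat_const; apply: leq_sum => c; rewrite in_setD => /andP[cX cC].
  apply/subset_leq_card/subsetP=> x xX; rewrite in_setI (subsetP sX) // andbT inE adj_sym.
  by apply: XC => //; apply: contraNneq cX => ->.
(* The neighbours inside [C] complete each summand to twice a degree, so the lower bound [inner] on
   them is what is saved. *)
have twice : \sum_(c in C) (deg G c + #|nbr G c :\: C|) + \sum_(c in C) #|nbr G c :&: C|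
    <= 2 * D * #|C|.
  rewrite -big_split mulnC -sum_nat_const; apply: leq_sum => c _ /=.
  by have := cardsID C (nbr G c); have := degD c; rewrite /deg -/(nbr _ _); lia.
have cp : #|C| + p <= D.+1 by rewrite cardsID.
have cq : #|C| + q <= D.+1 by rewrite /C setIC cardsID.
have Xc := subset_leq_card sX; move: le1; rewrite sumf.
move: twice inner cp cq Xc xi0 xiX XD; rewrite -/C.
move: (\sum_v deg G v) (\sum_(c in C) _) (\sum_(c in C) _) (\sum_v _) #|C| #|X|.
clear; move: p q => p q S T K M c x h1 h2 h3 h4 h5 h6 h7 h8 h9.
have [m em] : exists m, D.+1 = c + m by exists (D.+1 - c); lia.
have hp : p * p.-1 <= m * m.-1 by apply: leq_mul; lia.
have hq : q * q.-1 <= m * m.-1 by apply: leq_mul; lia.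
have hx : xi * (2 * D + 1 - xi) <= x * (2 * D + 1 - x).
  have [e ex] : exists e, x = xi + e by exists (x - xi); lia.
  have [g Dg] : exists g, D = x + g by exists (D - x); lia.
  have -> : 2 * D + 1 - xi = 2 * g + xi + 2 * e + 1 by lia.
  have -> : 2 * D + 1 - x = 2 * g + xi + e + 1 by lia.
  by rewrite ex; clear; nia.
(* The two sides differ by [2 * m * (c - x)]. *)
suff : 2 * D * c + 2 * (m * m.-1) + x * (2 * D + 1 - x) <=
       2 * (D * D.+1) + (x * c.-1 + (c - x) * x) by lia.
have [e ec] : exists e, c = x + e by exists (c - x); lia.
have [y ey] : exists y : nat, x = y.+1 by exists x.-1; lia.
have -> : D = y + e + m by lia.
have -> : 2 * (y + e + m) + 1 - x = y + 2 * e + 2 * m by lia.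
have -> : c - x = e by lia.
by rewrite ec ey /=; case: (m) => [|r] /=; clear; nia.
Qed.

End Threshold.

(** * Switchings towards a threshold graph *)

Section ThresholdEmbedding.
Variables (V : finType) (P : rel V) (D xi : nat).
Implicit Types (G H : sgraph V) (a b u v w x y z : V).

Hypotheses (Psym : symmetric P) (Pirr : irreflexive P).
(* [P] contains no alternating 4-cycle, that is, it is a threshold graph. *)
Hypothesis Pthr : forall u v x y, P u v -> P x y -> u != x -> v != y -> P u x || P v y.
Hypothesis xi0 : 0 < xi.

(** [room] ensures that an end of a missing edge of [P] has at least [xi] neighbours outside [P];
    [dense] is the failure of the inequality in [cover_bound]. *)
Let room G := forall v w, P v w -> #|[set x | P v x]| + xi <= (deg G v).+1.
Let dense G := \sum_v #|[set w | P v w]| + 2 * (D * D.+1) <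
               \sum_v deg G v + xi * (2 * D + 1 - xi).

Lemma free_neighbours G u v : room G -> P u v -> ~~ G u v ->
  xi <= #|[set x | G u x && ~~ P u x]|.
Proof.
move=> roomG Puv nuv; have := roomG _ _ Puv.
have := cardsD1 v [set x | P u x]; rewrite inE Puv.
have sub : nbr G u :&: [set x | P u x] \subset [set x | P u x] :\ v.
  by apply/subsetP=> x; rewrite !inE => /andP[ux ->]; rewrite andbT; apply: contraNneq nuv => <-.
have := subset_leq_card sub; rewrite /deg -/(nbr G u).
have := cardsID [set x | P u x] (nbr G u).
rewrite (_ : nbr G u :\: [set x | P u x] = [set x | G u x && ~~ P u x]).
  by move: (#|_|) (#|_|) (#|_|) (#|_|) (#|_|); lia.
by apply/setP=> x; rewrite !inE andbC.
Qed.

(** Let [X] and [Y] be the neighbours of [u] and [v] outside [P]. If no trail of length 4 or 6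
    through [uv] can be switched, the common closed neighbourhoods [A] of [X] and [B] of [Y] cover
    the edges outside [P], and [cover_bound] contradicts [dense]. *)
Lemma threshold_step G u v :
    (forall v, deg G v <= D) -> room G -> dense G -> P u v -> ~~ G u v ->
  exists2 H, same_deg G H & H u v /\ forall a b, P a b -> G a b -> H a b.
Proof.
move=> degD roomG denseG Puv nuv; apply: contrapT => nex.
have uv : u != v by apply: contraTneq Puv => ->; rewrite Pirr.
pose X := [set x | G u x && ~~ P u x]; pose Y := [set y | G v y && ~~ P v y].
have NE1 x y : x \in X -> y \in Y -> (x == y) || G x y.
  rewrite !inE => /andP[ux Pux] /andP[vy Pvy]; apply: contraPT (nex).
  rewrite negb_or => /andP[xy nxy] {}nex; apply: nex.
  have [H dH EH] := switch2 uv nuv xy nxy ux vy.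
  exists H => //; split=> [|a b Pab Gab]; first by rewrite EH upairxx orbT.
  rewrite EH Gab /= -!negb_or; apply/orP; left; apply/negP=> /orP[] /orP[] /andP[/eqP ea /eqP eb].
  - by rewrite -ea -eb Pab in Pux.
  - by rewrite -ea -eb Psym Pab in Pux.
  - by rewrite -ea -eb Pab in Pvy.
  - by rewrite -ea -eb Psym Pab in Pvy.
have NE2 x y z w : x \in X -> y \in Y -> G z w -> ~~ P z w ->
    [|| z == x, G x z, w == y | G y w].
  move=> xX yY zw Pzw; have xy := NE1 _ _ xX yY; move: xX yY.
  rewrite !inE => /andP[ux Pux] /andP[vy Pvy]; apply: contraPT (nex).
  rewrite !negb_or => /and4P[zx nxz wy nyw] {}nex; apply: nex.
  rewrite eq_sym in zx; rewrite eq_sym in wy.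
  have [H dH EH] := switch3 uv nuv xy zx nxz wy nyw ux vy zw.
  exists H => //; split=> [|a b Pab Gab]; first by rewrite EH upairxx orbT.
  rewrite EH Gab /= -!negb_or; apply/orP; left; apply/negP=> /or3P[] /orP[] /andP[/eqP ea /eqP eb].
  - by rewrite -ea -eb Pab in Pux.
  - by rewrite -ea -eb Psym Pab in Pux.
  - by rewrite -ea -eb Pab in Pvy.
  - by rewrite -ea -eb Psym Pab in Pvy.
  - by rewrite -ea -eb Pab in Pzw.
  - by rewrite -ea -eb Psym Pab in Pzw.
pose A := [set z | [forall x in X, (z == x) || G x z]].
pose B := [set w | [forall y in Y, (w == y) || G y w]].
have notinA z : z \notin A -> exists x, [/\ x \in X, z != x & ~~ G x z].
  rewrite inE negb_forall_in => /exists_inP[x xX]; rewrite negb_or => /andP[zx xz].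
  by exists x.
have notinB w : w \notin B -> exists y, [/\ y \in Y, w != y & ~~ G y w].
  rewrite inE negb_forall_in => /exists_inP[y yY]; rewrite negb_or => /andP[wy yw].
  by exists y.
have cover z w : G z w -> ~~ P z w -> (z \in A) || (w \in B).
  move=> zw Pzw; apply: contraT; rewrite negb_or => /andP[/notinA[x [xX zx xz]]].
  case/notinB=> y [yY wy yw].
  by have := NE2 _ _ _ _ xX yY zw Pzw; rewrite !(negbTE zx, negbTE xz, negbTE wy, negbTE yw).
have XB : X \subset B.
  by apply/subsetP=> x xX; rewrite inE; apply/forall_inP=> y yY; rewrite adj_sym NE1.
have YA : Y \subset A.
  by apply/subsetP=> y yY; rewrite inE; apply/forall_inP=> x xX; rewrite eq_sym NE1.
(* Here the threshold property enters: [x1] outside [A] and [y1] outside [B] would span an edge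
   which is not in [P], as [ux1] and [vy1] are not, and which [NE2] excludes. *)
have XY : X \subset A \/ Y \subset B.
  apply: contrapT => /not_orP[/negP/subsetPn[x1 x1X /notinA[x0 [x0X x10 nx]]]].
  case/negP/subsetPn=> y1 y1Y /notinB[y0 [y0Y y10 ny]].
  have [e|x1y1] := eqVneq x1 y1.
    have := NE1 _ _ x0X y1Y; rewrite -e eq_sym (negbTE x10) /= => x01.
    by rewrite x01 in nx.
  have x1y1G : G x1 y1 by have := NE1 _ _ x1X y1Y; rewrite (negbTE x1y1).
  have Px1y1 : ~~ P x1 y1.
    move: x1X y1Y; rewrite !inE => /andP[ux1 nP1] /andP[vy1 nP2].
    apply/negP=> Pxy; have := Pthr Puv Pxy (adj_neq ux1) (adj_neq vy1).
    by rewrite (negbTE nP1) (negbTE nP2).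
  have := NE2 _ _ _ _ x0X y0Y x1y1G Px1y1.
  by rewrite (negbTE x10) (negbTE nx) (negbTE y10) (negbTE ny).
have cX : xi <= #|X| := free_neighbours roomG Puv nuv.
have cY : xi <= #|Y| by apply: free_neighbours roomG _ _; rewrite 1?Psym 1?adj_sym; eauto.
have [x xX] : exists x, x \in X by apply/card_gt0P; apply: leq_trans cX.
have [y yY] : exists y, y \in Y by apply/card_gt0P; apply: leq_trans cY.
have closed w : #|w |: nbr G w| <= D.+1 by rewrite cardsU1 inE adj_irr add1n ltnS degD.
have leA : #|A| <= D.+1.
  apply: leq_trans (closed x); apply/subset_leq_card/subsetP=> z.
  by rewrite !inE => /forall_inP; apply.
have leB : #|B| <= D.+1.
  apply: leq_trans (closed y); apply/subset_leq_card/subsetP=> z.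
  by rewrite !inE => /forall_inP; apply.
have XD : #|X| <= D.
  by apply: leq_trans (degD u); apply/subset_leq_card/subsetP=> z; rewrite !inE => /andP[].
have YD : #|Y| <= D.
  by apply: leq_trans (degD v); apply/subset_leq_card/subsetP=> z; rewrite !inE => /andP[].
move: denseG; rewrite /dense ltnNge => /negP; apply.
have [XA|YB] := XY.
  apply: (@cover_bound V G P A B X) => //; first by rewrite subsetI XA.
  move=> x' c x'X; rewrite !inE => /andP[/forall_inP/(_ x' x'X) h _] cx.
  by move: h; rewrite (negbTE cx).
apply: (@cover_bound V G P A B Y) => //; first by rewrite subsetI YA.
move=> y' c y'Y; rewrite !inE => /andP[_ /forall_inP/(_ y' y'Y) h] cy.
by move: h; rewrite (negbTE cy).
Qed.

(** A realization with the most edges of [P] has them all, as [threshold_step] would add a missing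
    one and lose none. *)
Lemma threshold_realization G :
    (forall v, deg G v <= D) -> room G -> dense G ->
  exists2 H, same_deg G H & forall a b, P a b -> H a b.
Proof.
move=> degD roomG denseG.
pose present H := #|[set p : V * V | P p.1 p.2 && H p.1 p.2]|.
have [|H _|H dH maxH] := @exists_maximal _ (same_deg G) present #|{: V * V}| G.
- by [].
- exact: max_card.
exists H => // u v Puv; apply: contraT => nuv.
have [|||K dK [Kuv keep]] := @threshold_step H u v _ _ _ Puv nuv.
- by move=> w; rewrite dH.
- by move=> w w' /roomG; rewrite dH.
- by rewrite /dense (eq_bigr (deg G) (fun v _ => dH v)).
have := maxH K (same_deg_trans dH dK); rewrite leqNgt => /negP[].
apply/proper_card/properP; split.
  by apply/subsetP=> -[a b]; rewrite !inE /= => /andP[Pab Hab]; rewrite Pab keep.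
by exists (u, v); rewrite !inE /= Puv ?Kuv ?(negbTE nuv).
Qed.

End ThresholdEmbedding.

(** * The graph to be found *)

Section Target.
Variable V : finType.
Implicit Types (G H : sgraph V) (a b c s t u v w x y z : V) (T U W Z : {set V}).

(* Locked, so that [inE] does not unfold membership. *)
Fact verts_key : unit. Proof. by []. Qed.
Definition verts W a b c := locked_with verts_key (a |: (b |: (c |: W))).

Lemma vertsE W a b c : verts W a b c = a |: (b |: (c |: W)).
Proof. by rewrite /verts unlock. Qed.

(** Under [shape k] this is the complete graph on [k + 3] vertices without the edges of the path
    [a c b]. *)
Definition target W a b c : rel V := fun x y =>
  [&& x != y, x \in verts W a b c, y \in verts W a b c &
      [|| x \in W, y \in W | upair x y a b]].

Definition shape k W a b c := #|W| = k /\ #|verts W a b c| = k + 3.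

Definition has_target G W a b c := forall x y, target W a b c x y -> G x y.

Lemma in_verts W a b c x :
  (x \in verts W a b c) = [|| x == a, x == b, x == c | x \in W].
Proof. by rewrite vertsE !inE. Qed.

Lemma sub_verts W a b c : W \subset verts W a b c.
Proof. by apply/subsetP=> x xW; rewrite in_verts xW !orbT. Qed.

Lemma shapeP k W a b c : shape k W a b c <->
  #|W| = k /\ [&& a != b, a != c, b != c, a \notin W, b \notin W & c \notin W].
Proof.
split=> -[cW h]; split=> //.
  move: h; rewrite vertsE !cardsU1 !inE cW !negb_or.
  by case: (a == b) (a == c) (b == c) (a \in W) (b \in W) (c \in W)
    => [] [] [] [] [] /=; clear; lia.
rewrite vertsE !cardsU1 !inE cW !negb_or; case/and5P: h => -> -> -> -> /andP[-> ->] /=.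
by rewrite !add1n addn3.
Qed.

Lemma target_sym W a b c : symmetric (target W a b c).
Proof.
move=> x y; rewrite /target eq_sym upairC; congr (_ && _); rewrite andbCA.
by do 2!congr (_ && _); rewrite orbCA.
Qed.

Lemma target_irr W a b c : irreflexive (target W a b c).
Proof. by move=> x; rewrite /target eqxx. Qed.

(** A vertex of [W] is joined to all the others. With no end in [W], both edges are [ab], in
    opposite directions since [u != x]. *)
Lemma target_threshold W a b c u v x y :
  target W a b c u v -> target W a b c x y -> u != x -> v != y ->
  target W a b c u x || target W a b c v y.
Proof.
rewrite /target => /and4P[_ -> ->] + /and4P[_ -> ->] + ux vy; rewrite ux vy /=.
have [|uW] //= := boolP (u \in W); have [|vW] //= := boolP (v \in W); rewrite ?orbT //.
have [|xW] //= := boolP (x \in W); have [|yW] //= := boolP (y \in W); rewrite ?orbT //.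
move=> + xyab; move: xyab ux vy; rewrite /upair.
by case/orP=> /andP[/eqP-> /eqP->] ux vy /orP[] /andP[/eqP eu /eqP ev]; move: ux vy;
  rewrite eu ev !eqxx ?orbT.
Qed.

Lemma verts_tperm s t W a b c :
  verts (tperm s t @: W) (tperm s t a) (tperm s t b) (tperm s t c) =
  tperm s t @: verts W a b c.
Proof. by rewrite !vertsE !imsetU1. Qed.

Lemma in_tperm_imset s t (A : {set V}) x : (x \in tperm s t @: A) = (tperm s t x \in A).
Proof. by rewrite -{1}[x](tpermK s t) mem_imset //; apply: perm_inj. Qed.

Lemma target_tperm s t W a b c x y :
  target (tperm s t @: W) (tperm s t a) (tperm s t b) (tperm s t c) x y =
  target W a b c (tperm s t x) (tperm s t y).
Proof.
rewrite /target verts_tperm !in_tperm_imset (inj_eq perm_inj).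
have eqt z e : (z == tperm s t e) = (tperm s t z == e) by rewrite (can2_eq (tpermK s t) (tpermK s t)).
by rewrite /upair !eqt.
Qed.

Lemma shape_tperm s t k W a b c : shape k W a b c ->
  shape k (tperm s t @: W) (tperm s t a) (tperm s t b) (tperm s t c).
Proof. by case=> cW cv; split; rewrite ?verts_tperm card_imset //; apply: perm_inj. Qed.

Lemma verts_cons v W a b c : verts (v |: W) a b c = v |: verts W a b c.
Proof. by apply/setP=> x; rewrite !(in_verts, inE); case: (x == v); rewrite ?orbT. Qed.

Lemma shape_cons k v W a b c : v \notin verts W a b c ->
  shape k W a b c -> shape k.+1 (v |: W) a b c.
Proof.
move=> vv [cW cv]; have vW : v \notin W by apply: contra vv; apply/subsetP/sub_verts.
by rewrite /shape verts_cons (cardsU1 v W) (cardsU1 v (verts W a b c)) cW cv vv vW.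
Qed.

Lemma pick_shape k T : k + 3 <= #|T| ->
  exists W a b c, shape k W a b c /\ verts W a b c \subset T.
Proof.
move=> kT; have /card_gt0P[a aT] : 0 < #|T| by lia.
have c1 := cardsD1 a T; rewrite aT in c1.
have /card_gt0P[b bT] : 0 < #|T :\ a| by lia.
have c2 := cardsD1 b (T :\ a); rewrite bT in c2.
have /card_gt0P[c cT] : 0 < #|T :\ a :\ b| by lia.
have c3 := cardsD1 c (T :\ a :\ b); rewrite cT in c3.
have [|W WT cW] := @subset_of_card V (T :\ a :\ b :\ c) k; first by lia.
exists W, a, b, c; split.
  have out z : z \in W -> [&& z != c, z != b, z != a & z \in T].
    by move/(subsetP WT); rewrite !inE.
  apply/shapeP; split=> //; move: bT cT; rewrite !inE => /andP[ba _] /and3P[cb ca _].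
  rewrite [a == b]eq_sym ba [a == c]eq_sym ca [b == c]eq_sym cb /=.
  by apply/and3P; split; apply/negP=> /out; rewrite eqxx ?andbF.
apply/subsetP=> z; rewrite in_verts; move: bT cT; rewrite !inE.
move=> /andP[_ bT] /and3P[_ _ cT] /or4P[/eqP->|/eqP->|/eqP->|] //.
by move/(subsetP WT); rewrite !inE => /and4P[].
Qed.

Lemma clique_target G k T : k + 3 <= #|T| ->
  (forall x y, x \in T -> y \in T -> x != y -> G x y) ->
  exists W a b c, [/\ shape k W a b c, verts W a b c \subset T & has_target G W a b c].
Proof.
move=> kT cl; have [W [a [b [c [sh sT]]]]] := pick_shape kT.
exists W, a, b, c; split=> // x y /and4P[xy xv yv _].
by apply: cl => //; apply: (subsetP sT).
Qed.

Lemma deg_target k W a b c v : shape k W a b c ->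
  #|[set w | target W a b c v w]| <=
    (v \in W) * (k + 2) + (v \in [set a]) * k.+1 + (v \in [set b]) * k.+1 + (v \in [set c]) * k.
Proof.
move=> sh; have /shapeP[cW /and5P[ab ac bc aW /andP[bW cW']]] := sh.
have [vW|vW] := boolP (v \in W).
  apply: (@leq_trans #|verts W a b c :\ v|).
    apply/subset_leq_card/subsetP=> w; rewrite !inE => /and4P[vw _ + _].
    by rewrite [w == v]eq_sym vw.
  have := cardsD1 v (verts W a b c); rewrite (subsetP (sub_verts W a b c)) // sh.2.
  by move: #|_| => ?; clear; lia.
rewrite !in_set1.
have [->|va] := eqVneq v a.
  rewrite (negbTE ab) (negbTE ac) mul0n !addn0 !mul1n add0n -cW.
  apply: (@leq_trans #|b |: W|); last by rewrite cardsU1 bW.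
  apply/subset_leq_card/subsetP=> w; rewrite !inE => /and4P[aw _ _].
  rewrite (negbTE aW) /= /upair eqxx [w == a]eq_sym (negbTE aw) andbF orbF /= orbC.
  by [].
have [->|vb] := eqVneq v b.
  rewrite (negbTE bc) !mul0n !addn0 !mul1n add0n -cW.
  apply: (@leq_trans #|a |: W|); last by rewrite cardsU1 aW.
  apply/subset_leq_card/subsetP=> w; rewrite !inE => /and4P[bw _ _].
  by rewrite (negbTE bW) /= /upair eqxx [w == b]eq_sym (negbTE bw) andbF /= orbC.
have [->|vc] := eqVneq v c.
  rewrite !mul0n mul1n !add0n -cW.
  apply/subset_leq_card/subsetP=> w; rewrite !inE => /and4P[_ _ _].
  by rewrite (negbTE cW') /upair [c == a]eq_sym [c == b]eq_sym (negbTE ac) (negbTE bc) orbF.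
rewrite leqn0 cards_eq0; apply/eqP/setP=> w; rewrite !inE /target in_verts.
by rewrite (negbTE va) (negbTE vb) (negbTE vc) (negbTE vW) !andbF.
Qed.

Lemma sum_deg_target k W a b c : shape k W a b c ->
  \sum_v #|[set w | target W a b c v w]| <= k * (k + 2) + k.+1 + k.+1 + k.
Proof.
move=> sh; apply: leq_trans (leq_sum _ (fun v _ => deg_target v sh)) _.
by rewrite !big_split /= !sum_if_const !cards1 !mul1n sh.1.
Qed.

(** The edges between [Z] and the rest are charged twice to their ends outside [Z]; what remains of
    the degrees in [Z] is at most that of a clique. *)
Lemma sum_deg_cover G U Z e :
    Z \subset U -> (forall v, v \notin U -> deg G v = 0) ->
    (forall v, v \in U -> v \notin Z -> deg G v + #|nbr G v :&: Z| <= e) ->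
  \sum_v deg G v <= #|Z| * #|Z|.-1 + (#|U| - #|Z|) * e.
Proof.
move=> ZU out hZ; rewrite (bigID (mem Z)) /=.
have -> : \sum_(v in Z) deg G v =
    \sum_(v in Z) #|nbr G v :&: Z| + \sum_(v in ~: Z) #|nbr G v :&: Z|.
  rewrite sum_nbr_exchange -big_split; apply: eq_bigr => v _.
  by rewrite /= cardsID.
rewrite -addnA; apply: leq_add.
  rewrite -sum_nat_const; apply: leq_sum => z zZ; rewrite [in leqRHS](cardsD1 z) zZ.
  apply/subset_leq_card/subsetP=> w; rewrite !inE => /andP[zw ->].
  by rewrite eq_sym (adj_neq zw).
have -> : \sum_(v | v \notin Z) deg G v = \sum_(v in ~: Z) deg G v.
  by apply: eq_bigl => v; rewrite inE.
rewrite -big_split /=.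
have -> : #|U| - #|Z| = #|U :\: Z| by rewrite cardsD (setIidPr ZU).
rewrite -sum_nat_const (bigID (mem U)) /= addnC big1 => [|v /andP[vZ vU]].
  rewrite add0n big_mkcond [leqRHS]big_mkcond; apply: leq_sum => v _.
  rewrite !inE; have [//|vZ] := boolP (v \in Z); case: (boolP (v \in U)) => //= vU.
  by rewrite addnC hZ.
rewrite (out _ vU) addn0; apply/eqP; rewrite cards_eq0 -subset0; apply/subsetP=> w.
have /eqP := out _ vU; rewrite cards_eq0 => /eqP/setP/(_ w); rewrite !inE => ->.
by [].
Qed.

End Target.

(** * A vertex of large degree *)

Section LargeDegree.
Variables (V : finType) (G : sgraph V) (U : {set V}) (v : V) (k : nat).
Implicit Types (H K : sgraph V) (a b c s t w x y z p q : V) (W : {set V}).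

Hypothesis isolated : forall w, w \notin U -> deg G w = 0.
Hypothesis maxv : 2 * k + 5 <= deg G v.
Hypothesis largeU : 4 * k + 20 <= #|U|.
Hypothesis largeS : k.+1 * (2 * #|U|) + 4 <= \sum_w deg G w + k.+1 * k.+2.

(** The index is shifted: [config] below provides the graph for [k], and the one for [k.+1] is
    wanted. *)
Let goal := exists H W a b c,
  [/\ same_deg G H, shape k.+1 W a b c, verts W a b c \subset U & has_target H W a b c].

Definition top_nbrs H :=
  forall p q, H v p -> ~~ H v q -> q != v -> deg G q <= deg G p.

Definition config H W a b c :=
  [/\ same_deg G H, top_nbrs H, shape k W a b c,
      verts W a b c \subset U :\ v & has_target H W a b c].

(* The weights make the comparison lexicographic: first the vertices of the graph
   missed by [v], then those of them that lie in the clique. *)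
Definition missing H W a b c :=
  (k + 5) * #|verts W a b c :\: nbr H v| + #|W :\: nbr H v|.

(** * Properties of a configuration minimizing [missing] *)

Section Minimal.
Variables (H : sgraph V) (W : {set V}) (a b c : V).
Hypothesis cfg : config H W a b c.
Hypothesis min : forall H' W' a' b' c',
  config H' W' a' b' c' -> missing H W a b c <= missing H' W' a' b' c'.

Let S := verts W a b c.
Let X := nbr H v :\: S.

Let dH : same_deg G H. Proof. by case: cfg. Qed.
Let top : top_nbrs H. Proof. by case: cfg. Qed.
Let sh : shape k W a b c. Proof. by case: cfg. Qed.
Let SU : S \subset U :\ v. Proof. by case: cfg. Qed.
Let FH : has_target H W a b c. Proof. by case: cfg. Qed.

Lemma verts_neq z : z \in S -> z != v.
Proof. by move/(subsetP SU); rewrite !inE => /andP[]. Qed.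

Lemma adj_support H' x y : same_deg G H' -> H' x y -> x \in U.
Proof.
move=> dH' xy; apply: contraT => /isolated; rewrite -dH' => /eqP.
by rewrite cards_eq0 => /eqP/setP/(_ y); rewrite !inE xy.
Qed.

(** The exchange is done with [v] deleted, and [v] then gets its neighbourhood back. The deletion
    costs [t] one degree and [s] none, which is why the inequality between degrees is strict. *)
Lemma no_exchange s t :
    s \in S -> ~~ H v s -> H v t -> deg G s < deg G t ->
    (forall y, target W a b c t y -> y != s -> target W a b c s y) ->
  missing H W a b c <=
    missing H (tperm s t @: W) (tperm s t a) (tperm s t b) (tperm s t c).
Proof.
move=> sS vs vt st dom; pose I := isolate H v.
have sv := verts_neq sS; have tv : t != v by rewrite eq_sym (adj_neq vt).
have s_t : s != t by apply: contraNneq vs => ->.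
have FI x y : target W a b c x y -> I x y.
  move=> xy; rewrite /= FH // andbT.
  by case/and4P: xy => _ /verts_neq-> /verts_neq->.
have dst : deg I s <= deg I t.
  have := deg_isolate H sv; have := deg_isolate H tv.
  rewrite !dH [H t v]adj_sym [H s v]adj_sym vt (negbTE vs) -/I.
  by move: st; clear; lia.
have [K dK FK] := exchange_embedding (target_sym _ _ _ _) (target_irr _ _ _ _) FI s_t dst dom.
have vN : v \notin nbr H v by rewrite inE adj_irr.
pose H' := star_at K vN.
have nbrH' : nbr H' v = nbr H v by rewrite nbr_star.
have -> : missing H (tperm s t @: W) (tperm s t a) (tperm s t b) (tperm s t c) =
          missing H' (tperm s t @: W) (tperm s t a) (tperm s t b) (tperm s t c).
  by rewrite /missing nbrH'.
apply: min; split.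
- by apply: same_deg_trans dH _; apply: same_deg_star.
- by move=> p q; rewrite !star_self !inE; apply: top.
- exact: shape_tperm.
- apply/subsetP=> z; rewrite verts_tperm in_tperm_imset => zS; rewrite !inE; move: zS.
  have [-> _|zs] := eqVneq z s; first by move: (subsetP SU s sS); rewrite !inE.
  have [->|zt] := eqVneq z t; first by rewrite tv (adj_support dH (y := v)) // adj_sym.
  have -> : tperm s t z = z by rewrite tpermD 1?eq_sym.
  by move=> zS; move: (subsetP SU z zS); rewrite !inE.
- move=> x y; rewrite target_tperm => xy; have := FK _ _ xy; rewrite !tpermK.
  have nv z : tperm s t z \in S -> z != v.
    move=> zS; apply: contraTneq zS => ->; rewrite tpermD //.
    by apply/negP=> /verts_neq; rewrite eqxx.
  by case/and4P: xy => _ /nv xv /nv yv _; rewrite star_out.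
Qed.

(** One inequality is [top]. If [x] had larger degree, it could replace [s]: it lies outside [S], so
    domination is void, and it is seen by [v], so fewer vertices would be missed. *)
Lemma deg_free s x : s \in S -> ~~ H v s -> x \in X -> deg G x = deg G s.
Proof.
move=> sS vs; rewrite !inE => /andP[xS vx]; apply/eqP.
rewrite eqn_leq [in X in _ && X]top ?verts_neq // andbT leqNgt; apply/negP=> lt.
have dom y : target W a b c x y -> y != s -> target W a b c s y.
  by case/and4P=> _ xS'; rewrite (negbTE xS) in xS'.
have := no_exchange sS vs vx lt dom; apply/negP; rewrite -ltnNge /missing verts_tperm -/S.
have lt1 : #|(tperm s x @: S) :\: nbr H v| < #|S :\: nbr H v|.
  rewrite [ltnRHS](cardsD1 s) !inE sS vs ltnS; apply/subset_leq_card/subsetP=> z.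
  rewrite in_setD in_tperm_imset !inE => /andP[vz].
  have [->|zs] := eqVneq z s; first by rewrite tpermL (negbTE xS).
  have [zx|zx] := eqVneq z x; first by rewrite zx vx in vz.
  by rewrite tpermD 1?eq_sym // => ->; rewrite vz.
have : #|(tperm s x @: W) :\: nbr H v| <= k.
  rewrite -sh.1 -[leqRHS](card_imset _ (@perm_inj _ (tperm s x))).
  by rewrite subset_leq_card // subsetDl.
move: lt1; move: #|_| #|_| #|_| #|_| => m1 m2 m3 m4; clear; nia.
Qed.

Section Free.
Variables s : V.
Hypotheses (sS : s \in S) (vs : ~~ H v s).

Lemma card_free : k + 3 <= #|X|.
Proof.
have : deg H v <= #|X| + #|S :\ s|.
  rewrite /deg -/(nbr H v) -(cardsID S (nbr H v)) addnC leq_add2l.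
  apply/subset_leq_card/subsetP=> z; rewrite !inE => /andP[vz ->].
  by rewrite andbT; apply: contraNneq vs => <-.
have := cardsD1 s S; rewrite sS sh.2 dH; move: maxv.
by move: #|_| #|_| (deg G v); clear; lia.
Qed.

Lemma nbr_deg_ge p : H v p -> deg G s <= deg G p.
Proof. by move=> vp; apply: top => //; apply: verts_neq. Qed.

Lemma nonnbr_deg_le q : ~~ H v q -> q != v -> deg G q <= deg G s.
Proof.
have /card_gt0P[x xX] : 0 < #|X| by apply: leq_trans card_free; rewrite addnS.
move=> vq qv; rewrite -(deg_free sS vs xX); apply: top => //.
by move: xX; rewrite !inE => /andP[].
Qed.

(** Only vertices with the degree of [s] enter or leave the neighbourhood of [v], so it still
    consists of vertices of largest degree. As [s] enters and no vertex of [S] leaves, minimality is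
    violated. *)
Lemma no_improvement H' :
    same_deg G H' -> has_target H' W a b c -> H' v s ->
    (forall z, H' v z -> H v z \/ deg G z = deg G s) ->
    (forall z, H v z -> ~~ H' v z -> z \notin S /\ deg G z = deg G s) -> False.
Proof.
move=> dH' FH' vs' new old.
have cfg' : config H' W a b c.
  split=> // p q /new vp vq qv; apply: (@leq_trans (deg G s)).
    have [/old/(_ vq)[_ ->]//|nvq] := boolP (H v q); exact: nonnbr_deg_le.
  by case: vp => [/nbr_deg_ge|->].
have keep z : z \in S -> ~~ H' v z -> ~~ H v z.
  by move=> zS vz; apply: contraL zS => /old/(_ vz)[].
have := min cfg'; apply/negP; rewrite -ltnNge /missing -/S.
have lt1 : #|S :\: nbr H' v| < #|S :\: nbr H v|.
  rewrite [ltnRHS](cardsD1 s) !inE sS vs ltnS; apply/subset_leq_card/subsetP=> z.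
  rewrite !inE => /andP[vz zS]; rewrite keep // zS !andbT.
  by apply: contraNneq vz => ->.
have : #|W :\: nbr H' v| <= #|W :\: nbr H v|.
  apply/subset_leq_card/subsetP=> z; rewrite !inE => /andP[vz zW].
  by rewrite zW andbT keep // (subsetP (sub_verts _ _ _ _)).
move: lt1; move: #|_| #|_| #|_| #|_| => m1 m2 m3 m4; clear; nia.
Qed.

(** Otherwise replacing [vx] and [sy] by [vs] and [xy] is an improvement. *)
Lemma free_adjacent y x :
  H s y -> ~~ target W a b c s y -> x \in X -> (x == y) || H x y.
Proof.
move=> sy nsy xX; apply: contraT; rewrite negb_or => /andP[xy nxy].
have dx := deg_free sS vs xX; move: xX; rewrite !inE => /andP[xS vx].
have sv := verts_neq sS; have vs_ne : v != s by rewrite eq_sym.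
have [H' dH' EH'] := switch2 vs_ne vs xy nxy vx sy.
have yv : y != v by apply: contraNneq vs => <-; rewrite adj_sym.
exfalso; apply: (no_improvement (same_deg_trans dH dH')).
- move=> p q pq; rewrite EH' FH //=; apply/orP; left; rewrite -negb_or.
  move: (pq) => /and4P[_ pS qS _]; rewrite /upair.
  rewrite (negbTE (verts_neq pS)) (negbTE (verts_neq qS)) andbF /=.
  apply/negP=> /orP[] /andP[/eqP ep /eqP eq]; first by rewrite -ep -eq pq in nsy.
  by rewrite -ep -eq target_sym pq in nsy.
- by rewrite EH' upairxx orbT.
- move=> z; rewrite EH' /upair !eqxx (negbTE vs_ne) [v == y]eq_sym (negbTE yv) /=.
  rewrite [v == x]eq_sym; have [xv|_] := eqVneq x v; first by rewrite xv adj_irr in vx.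
  rewrite /= !orbF => /orP[/andP[->]|/eqP->]; [by left | by right].
- move=> z vz; have [->|zx] := eqVneq z x; first by rewrite xS dx.
  rewrite EH' vz /upair (negbTE zx) (negbTE vs_ne) [v == y]eq_sym (negbTE yv) /=.
  have [zv|_] := eqVneq z v; first by rewrite zv adj_irr in vz.
  by rewrite !andbF.
Qed.

(** If [x] and [x'] are not adjacent, failing switches of length 6 make [y] adjacent to the other
    neighbours of [x'], with a proviso for [v]. As [y] also sees [x] and [x'], its degree becomes
    too large. *)
Lemma free_clique y x x' :
  H s y -> y \notin S -> x \in X -> x' \in X -> x != x' -> H x x'.
Proof.
move=> sy yS xX x'X xx'; apply: contraT => nxx'.
have nsy : ~~ target W a b c s y by apply: contra yS => /and4P[].
have xy := free_adjacent sy nsy xX; have x'y := free_adjacent sy nsy x'X.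
have y_x : y != x.
  by apply: contraNneq nxx' => e; move: x'y; rewrite e eq_sym (negbTE xx') /= adj_sym.
have y_x' : y != x'.
  by apply: contraNneq nxx' => e; move: xy; rewrite e (negbTE xx').
have {}xy : H x y by move: xy; rewrite eq_sym (negbTE y_x).
have {}x'y : H x' y by move: x'y; rewrite eq_sym (negbTE y_x').
have dx := deg_free sS vs xX; have dx' := deg_free sS vs x'X.
move: (xX) (x'X); rewrite !inE => /andP[xS vx] /andP[x'S vx'].
have sv := verts_neq sS; have vs_ne : v != s by rewrite eq_sym.
have yv : y != v by apply: contraNneq vs => <-; rewrite adj_sym.
have x'v : x' != v by rewrite eq_sym (adj_neq vx').
have xv : x != v by rewrite eq_sym (adj_neq vx).
have dy : deg G y <= deg G s.
  have [vy|vy] := boolP (H v y); last exact: nonnbr_deg_le.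
  by rewrite (deg_free sS vs) // !inE vy yS.
(* For [q = v] the switch makes [y] a new neighbour of [v], which [no_improvement] allows only when
   [y] has the degree of [s]. *)
have blocked q : H x' q -> q != y -> (q != v) || (deg G y == deg G s) -> H y q.
  move=> x'q qy hq; apply: contraT => nyq.
  have xy' : (x == y) || H x y by rewrite xy orbT.
  have y_q : y != q by rewrite eq_sym.
  have [H' dH' EH'] := switch3 vs_ne vs xy' xx' nxx' y_q nyq vx sy x'q.
  exfalso; apply: (no_improvement (same_deg_trans dH dH')).
  - move=> p r pr; rewrite EH' FH //=; apply/orP; left; rewrite -!negb_or.
    move: (pr) => /and4P[_ pS rS _].
    have out z : z \in S -> [/\ z != v, z != x' & z != y].
      by move=> zS; split; [exact: verts_neq | |]; apply: contraTneq zS => ->.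
    have [pv px' py] := out p pS; have [rv rx' ry] := out r rS.
    by rewrite /upair !(negbTE pv, negbTE px', negbTE py, negbTE rv, negbTE rx', negbTE ry) !andbF.
  - by rewrite EH' upairxx orbT.
  - move=> z; rewrite EH' /upair !eqxx (negbTE vs_ne) [v == y]eq_sym (negbTE yv) /=.
    rewrite [v == x]eq_sym (negbTE xv) [v == x']eq_sym (negbTE x'v) /=.
    case/or3P=> [/andP[->]||]; [by left | by case/orP=> // /eqP->; right | ].
    case/andP=> /eqP vq /eqP->; right; move: hq; rewrite -vq eqxx /=; exact: eqP.
  - move=> z vz; have zv : z != v by rewrite eq_sym (adj_neq vz).
    have [->|zx] := eqVneq z x; first by rewrite xS dx.
    have [->|zx'] := eqVneq z x'; first by rewrite x'S dx'.
    rewrite EH' vz /upair (negbTE zx) (negbTE zv) (negbTE vs_ne) [v == y]eq_sym (negbTE yv) /=.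
    by rewrite [v == x']eq_sym (negbTE x'v) (negbTE zx') !andbF.
have sub : (nbr H x' :\ y) :\ v \subset ((nbr H y :\ x) :\ x') :\ v.
  apply/subsetP=> q; rewrite !inE => /and3P[qv qy x'q].
  rewrite qv blocked ?qv // andbT eq_sym (adj_neq x'q) /=.
  by apply: contraTneq x'q => ->; rewrite adj_sym.
have := subset_leq_card sub.
have := cardsD1 y (nbr H x'); have := cardsD1 v (nbr H x' :\ y).
have := cardsD1 x (nbr H y); have := cardsD1 x' (nbr H y :\ x).
have := cardsD1 v (nbr H y :\ x :\ x').
rewrite !inE x'y [H y x]adj_sym xy [H y x']adj_sym x'y [x' == x]eq_sym xx' [H x' v]adj_sym vx'.
rewrite [v == y]eq_sym (negbTE yv) [v == x]eq_sym (negbTE xv) [v == x']eq_sym (negbTE x'v) /=.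
have ex' : #|nbr H x'| = deg G s by rewrite -dx' -dH.
have ey : #|nbr H y| = deg G y by rewrite -dH.
(* Counting forces [y] to have the degree of [s] and not to be adjacent to [v]; then [blocked]
   applies to [v] itself. *)
rewrite ex' ey; have := blocked v; rewrite [H x' v]adj_sym vx' [v == y]eq_sym yv eqxx /=.
move=> /(_ isT isT); move: dy; case: (H y v).
  by move: (deg G y) (deg G s) (#|_|) (#|_|) (#|_|) (#|_|) (#|_|); clear; lia.
move: (deg G y) (deg G s) => dy ds; have [->|ne] := eqVneq dy ds; first by move=> _ /(_ isT).
by move: ne; move: (#|_|) (#|_|) (#|_|) (#|_|) (#|_|); clear; lia.
Qed.

End Free.
End Minimal.
(** If [v] sees all of [S], it joins the clique. Otherwise, arguing by contradiction, a missed [s]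
    has neighbourhood [S :\ s], and at most one more switch makes [v |: S] complete up to the pair
    [vs]. *)
Lemma goal_of_minimal H W a b c :
    config H W a b c ->
    (forall H' W' a' b' c', config H' W' a' b' c' ->
       missing H W a b c <= missing H' W' a' b' c') ->
  goal.
Proof.
move=> cfg min; apply: contrapT => ngoal.
have [dH top sh SU FH] := cfg; set S := verts W a b c in SU.
have vS : v \notin S by apply/negP=> /(subsetP SU); rewrite !inE eqxx.
have vU : v \in U.
  by apply: contraT => /isolated d0; move: maxv; rewrite d0 addnC.
have SU' : S \subset U by apply: subset_trans SU (subsetDl _ _).
have sumH : \sum_w deg H w = \sum_w deg G w by apply: eq_bigr.
have isoH w : w \notin U -> deg H w = 0 by rewrite dH; apply: isolated.
have notall : ~~ (S \subset nbr H v).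
  apply/negP=> /subsetP SN; apply: ngoal; exists H, (v |: W), a, b, c.
  split=> //; first exact: shape_cons.
    by rewrite verts_cons subUset sub1set vU SU'.
  move=> x y /and4P[xy]; rewrite verts_cons -/S !in_setU1.
  have [xv|xv] := eqVneq x v; have [yv|yv] := eqVneq y v => //= xS yS WW.
  - by rewrite xv yv eqxx in xy.
  - by have := SN y yS; rewrite xv inE.
  - by have := SN x xS; rewrite yv inE adj_sym.
  by apply: FH; apply/and4P.
have free s (sS : s \in S) (vs : ~~ H v s) :
    [/\ nbr H s = S :\ s, deg G s = k + 2 & s \notin W].
  (* A neighbour of [s] outside [S] makes [X] a clique; together with [v] it has at least [k + 4]
     vertices, enough for the goal. *)
  have inside : nbr H s \subset S :\ s.
    apply/subsetP=> y; rewrite inE => sy; rewrite !inE eq_sym (adj_neq sy) /=.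
    apply: contraT => yS; case: ngoal.
    pose X := nbr H v :\: S.
    have cX : k + 3 <= #|X| by apply: (card_free cfg sS).
    have [|x x'|W' [a' [b' [c' [sh' sX FH']]]]] := @clique_target V H k.+1 (v |: X).
    - by rewrite cardsU1 !inE adj_irr andbF add1n addSn ltnS.
    - rewrite !in_setU1 => /orP[/eqP->|xX] /orP[/eqP->|x'X] xx'.
      + by rewrite eqxx in xx'.
      + by move: x'X; rewrite !inE => /andP[].
      + by rewrite adj_sym; move: xX; rewrite !inE => /andP[].
      + exact: (free_clique cfg min sS vs sy yS).
    exists H, W', a', b', c'; split=> //; apply: subset_trans sX _.
    apply/subsetP=> z; rewrite in_setU1 => /orP[/eqP->//|].
    by rewrite !inE => /andP[_ vz]; apply: (adj_support (y := v) dH); rewrite adj_sym.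
  have cS : #|S :\ s| = k + 2.
    by have := cardsD1 s S; rewrite sS sh.2; move: #|_| => m; clear; lia.
  have small z : z != v -> z \notin S :\ s -> deg G z <= deg G s.
    move=> zv; rewrite !inE negb_and negbK => /orP[/eqP->//|zS].
    have [vz|vz] := boolP (H v z).
      by rewrite (deg_free cfg min sS vs) // !inE zS.
    exact: (nonnbr_deg_le cfg min sS vs).
  (* Otherwise all vertices outside the [k + 3] vertices of [Z] have degree at most [k + 1], and the
     bound of [sum_deg_cover] is 2 below the assumed degree sum. *)
  have ds : k + 2 <= deg G s.
    rewrite leqNgt; apply/negP=> lt.
    pose Z := v |: (S :\ s).
    have cZ : #|Z| = k + 3 by rewrite /Z cardsU1 cS !inE (negbTE vS) andbF add1n !addnS.
    have ZU : Z \subset U.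
      rewrite subUset sub1set vU; apply: subset_trans SU'; exact: subsetDl.
    have := @sum_deg_cover V H U Z (2 * k.+1) ZU isoH.
    have hZ z : z \in U -> z \notin Z -> deg H z + #|nbr H z :&: Z| <= 2 * k.+1.
      move=> _; rewrite in_setU1 negb_or => /andP[zv /(small z zv)].
      have : #|nbr H z :&: Z| <= deg H z by apply/subset_leq_card/subsetIl.
      by rewrite dH; move: (#|_ :&: _|) (deg G z) (deg G s) lt; clear; lia.
    move=> /(_ hZ); have := subset_leq_card ZU; rewrite sumH cZ.
    by move: largeS; move: (\sum_w _) #|U|; clear; nia.
  have eN : nbr H s = S :\ s by apply/eqP; rewrite eqEcard inside cS -[#|_|]/(deg H s) dH.
  have eds : deg G s = k + 2 by rewrite -dH /deg -/(nbr H s) eN.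
  split=> //; apply/negP=> sW.
  pose T := [set z | k + 3 <= deg G z].
  (* Otherwise the vertices of degree at least [k + 3] lie in [v |: (W :\ s)]: at most [k], too few
     for the degree sum. Exchanging [s] with such a [t] keeps [S] and leaves fewer missed vertices
     in the clique. *)
  have [t [tS tW tT]] : exists t, [/\ t \in S, t \notin W & t \in T].
    apply: contrapT => not; suff : #|T| <= k.
      have TU : T \subset U.
        by apply/subsetP=> z; rewrite inE; apply: contraTT => /isolated->; rewrite addnS.
      have hT z : z \in U -> z \notin T -> deg H z + #|nbr H z :&: T| <= k + 2 + #|T|.
        rewrite inE -ltnNge dH => _ lt; apply: leq_add; last exact/subset_leq_card/subsetIr.
        by rewrite -ltnS -addnS.
      have := sum_deg_cover TU isoH hT; rewrite sumH.
      have := subset_leq_card TU; move: largeS largeU; move: (\sum_w _) #|U| #|T|.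
      clear=> Sg n t h1 h2 h3 + h5.
      have [j kj] : exists j, k = t + j by exists (k - t); lia.
      have [m nm] : exists m, n = t + m by exists (n - t); lia.
      by move: h1 h2; rewrite kj nm addKn; case: (t) => [|t'] /=; nia.
    have TW : T \subset v |: (W :\ s).
      apply/subsetP=> z zT; rewrite !inE; have [//|zv] := eqVneq z v.
      have zd : deg G s < deg G z by move: zT; rewrite inE eds addnS.
      have zs : z != s by apply: contraTneq zd => ->; rewrite ltnn.
      rewrite zs /=; apply: contraT => zW; case: not; exists z; split=> //.
      by apply: contraTT zd => zS; rewrite -leqNgt small // !inE negb_and zS orbT.
    have := subset_leq_card TW; rewrite cardsU1.
    have := cardsD1 s W; rewrite sW sh.1.
    have -> : v \notin W :\ s.
      rewrite !inE negb_and orbC; apply/orP; left; apply: contra vS.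
      exact: (subsetP (sub_verts _ _ _ _)).
    by move: #|_| #|_|; clear; lia.
  have lt : deg G s < deg G t by move: tT; rewrite inE eds addnS.
  have tv : t != v by apply: contraTneq tS => ->.
  have vt : H v t.
    apply: contraTT lt => vt; rewrite -leqNgt.
    exact: (nonnbr_deg_le cfg min sS vs).
  have dom y : target W a b c t y -> y != s -> target W a b c s y.
    by move=> /and4P[_ _ yS _] ys; rewrite /target eq_sym ys sS yS sW.
  have := no_exchange cfg min sS vs vt lt dom.
  have fixS : tperm s t @: S = S.
    apply/setP=> z; rewrite in_tperm_imset.
    have [->|zs] := eqVneq z s; first by rewrite tpermL sS.
    have [->|zt] := eqVneq z t; first by rewrite tpermR sS tS.
    by rewrite tpermD 1?eq_sym.
  rewrite /missing verts_tperm -/S fixS leq_add2l; apply/negP; rewrite -ltnNge.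
  rewrite [ltnRHS](cardsD1 s) !inE sW vs ltnS; apply/subset_leq_card/subsetP=> z.
  rewrite in_setD in_tperm_imset !inE => /andP[vz].
  have [->|zs] := eqVneq z s; first by rewrite tpermL (negbTE tW).
  have [zt|zt] := eqVneq z t; first by rewrite zt vt in vz.
  by rewrite tpermD 1?eq_sym // => ->; rewrite vz.
have /subsetPn[s sS] := notall; rewrite inE => vs.
have [eN ds sW] := free s sS vs.
have WN w : w \in W -> H v w.
  move=> wW; apply: contraT => vw.
  by have [] := free w (subsetP (sub_verts _ _ _ _) w wW) vw; rewrite wW.
pose X := nbr H v :\: S.
have cX : k + 3 <= #|X| by apply: (card_free cfg sS).
have [p [q eS]] : exists p q, verts W s p q = S.
  move: (sS); rewrite in_verts (negbTE sW) orbF => /or3P[]/eqP->.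
  - by exists b, c.
  - exists a, c; apply/setP=> z; rewrite !in_verts.
    by case: (z == a); case: (z == b).
  - exists a, b; apply/setP=> z; rewrite !in_verts.
    by case: (z == a); case: (z == b); case: (z == c).
have eS' : verts W s q p = S.
  by rewrite -eS; apply/setP=> z; rewrite !in_verts; case: (z == p); case: (z == q).
have adjS z : z \in S -> z != s -> H s z.
  by move=> zS zs; have := in_setD1 z S s; rewrite -eN inE zs zS.
have Wadj x y : x \in S -> y \in S -> x != y -> (x \in W) || (y \in W) -> H x y.
  by move=> xS yS xy xyW; apply: FH; rewrite /target xy xS yS orbA xyW.
(* As [s] sees all of [S], the pair [s p1] can serve as the edge and [p2] as the single vertex, with
   [missing] unchanged. Then [s p2] is not among the wanted edges, and [free_adjacent] applies to
   it. *)
have adjX p1 p2 : verts W s p1 p2 = S -> forall x, x \in X -> H x p2.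
  move=> eS1 x xX; have sh1 : shape k W s p1 p2 by split; rewrite ?eS1 ?sh.1 ?sh.2.
  have /shapeP[_ /and5P[sp1 sp2 p12 _ /andP[p1W p2W]]] := sh1.
  have p1S : p1 \in S by rewrite -eS1 in_verts eqxx orbT.
  have p2S : p2 \in S by rewrite -eS1 in_verts eqxx !orbT.
  have cfg1 : config H W s p1 p2.
    split; rewrite ?eS1 // => y z /and4P[yz]; rewrite eS1 => yS zS.
    case/or3P=> [yW|zW|].
    - by apply: Wadj; rewrite ?yW.
    - by apply: Wadj; rewrite ?zW ?orbT.
    by case/orP=> /andP[/eqP-> /eqP->]; rewrite ?[H p1 s]adj_sym adjS // eq_sym.
  have min1 H' W' a' b' c' : config H' W' a' b' c' ->
      missing H W s p1 p2 <= missing H' W' a' b' c'.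
    by move=> cfg'; rewrite /missing eS1; apply: min.
  have sS1 : s \in verts W s p1 p2 by rewrite eS1.
  have xX1 : x \in nbr H v :\: verts W s p1 p2 by rewrite eS1.
  have xp2 : (x == p2) = false.
    by apply/negbTE; apply: contraTneq xX => ->; rewrite inE p2S.
  have := free_adjacent cfg1 min1 sS1 vs (adjS p2 p2S _) _ xX1; rewrite xp2; apply.
    by rewrite eq_sym.
  rewrite /target (negbTE sW) (negbTE p2W) /= /upair eqxx [p2 == p1]eq_sym (negbTE p12).
  by rewrite (negbTE sp1) !andbF.
have nbrX z : z \in S -> (forall x, x \in X -> H x z) -> H v z.
  move=> zS Xz; apply: contraT => vz; have [_ dz _] := free z zS vz.
  have : #|X| <= deg H z.
    by apply/subset_leq_card/subsetP=> x /Xz; rewrite inE adj_sym.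
  by rewrite dH dz; move: cX; move: #|_|; clear; lia.
have /shapeP[_ /and5P[sp sq pq _ /andP[pW qW]]] : shape k W s p q.
  by split; rewrite ?eS ?sh.1 ?sh.2.
have pS : p \in S by rewrite -eS in_verts eqxx orbT.
have qS : q \in S by rewrite -eS in_verts eqxx !orbT.
have Xp := adjX _ _ eS'; have Xq := adjX _ _ eS.
have vp := nbrX p pS Xp; have vq := nbrX q qS Xq.
have outX x : x \in X -> x \notin v |: S.
  by rewrite in_setU1 !inE negb_or => /andP[-> vx]; rewrite eq_sym (adj_neq vx).
(* If [X] were a clique, its vertices, also joined to [v], would have degree at least [k + 3], while
   [deg_free] gives [k + 2]. *)
have [x [x' [xX x'X xx' nxx']]] : exists x x', [/\ x \in X, x' \in X, x != x' & ~~ H x x'].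
  apply: contrapT => clique.
  have /card_gt0P[x xX] : 0 < #|X| by apply: leq_trans cX; rewrite addnS.
  have : #|v |: (X :\ x)| <= deg H x.
    apply/subset_leq_card/subsetP=> z; rewrite !in_setU1 => /orP[/eqP->|].
      by move: xX; rewrite !inE => /andP[_]; rewrite adj_sym.
    rewrite in_setD1 => /andP[zx zX]; rewrite inE; apply: contraT => xz.
    by case: clique; exists x, z; split=> //; rewrite eq_sym.
  rewrite dH (deg_free cfg min sS vs xX) ds cardsU1 !inE adj_irr !andbF.
  have := cardsD1 x X; rewrite xX; move: cX; move: #|_| #|_|; clear; lia.
(* Replacing [px] and [qx'] by [pq] and [xx'] removes no edge inside [v |: S]. *)
have [K dK [Kpq keep]] : exists2 K, same_deg H K & K p q /\
    forall y z, y \in v |: S -> z \in v |: S -> H y z -> K y z.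
  have [Hpq|nHpq] := boolP (H p q); first by exists H.
  have Hpx : H p x by rewrite adj_sym Xp.
  have Hqx : H q x' by rewrite adj_sym Xq.
  have [K dK EK] := switch2 pq nHpq xx' nxx' Hpx Hqx.
  exists K => //; split=> [|y z yS zS yz]; first by rewrite EK upairxx orbT.
  have nx y' : y' \in v |: S -> (y' == x = false) * (y' == x' = false).
    by move=> y'S; split; apply: contraTF y'S => /eqP->; apply: outX.
  by rewrite EK yz /upair !nx // !andbF.
have core y z : y \in v |: S -> z \in v |: S -> y != z -> ~~ upair y z v s -> K y z.
  have vS' z' : z' \in S -> z' != s -> H v z'.
    by rewrite -eS in_verts => /or4P[/eqP->|/eqP->|/eqP->|/WN]; rewrite ?eqxx.
  have sS' z' : z' \in S -> z' != s -> H z' s by move=> ? ?; rewrite adj_sym adjS.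
  move=> yS zS yz nvs; have [|npq] := boolP (upair y z p q).
    by case/orP=> /andP[/eqP-> /eqP->]; rewrite // adj_sym.
  apply: keep => //; move: yS zS; rewrite !in_setU1.
  have [yv|yv] := eqVneq y v; have [zv|zv] := eqVneq z v => //= yS zS.
  - by rewrite yv zv eqxx in yz.
  - rewrite yv vS' //; apply: contraNneq nvs => ->; by rewrite yv upairxx.
  - rewrite zv adj_sym vS' //; apply: contraNneq nvs => ->.
    by rewrite zv upairC upairxx.
  have [ys|ys] := eqVneq y s; first by rewrite ys adjS // -ys eq_sym.
  have [zs|zs] := eqVneq z s; first by rewrite zs sS'.
  have [yW|yW] := boolP (y \in W); first by rewrite Wadj ?yW.
  have [zW|zW] := boolP (z \in W); first by rewrite Wadj ?zW ?orbT.
  move: yS zS npq yz; rewrite -eS !in_verts (negbTE yW) (negbTE zW) (negbTE ys) (negbTE zs) !orbF /=.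
  by do 2![case/orP=> /eqP->]; rewrite ?upairxx ?[upair q p _ _]upairC ?upairxx ?eqxx.
have vertsK : verts (p |: W) v q s = v |: S.
  rewrite -eS; apply/setP=> z; rewrite !(in_verts, in_setU1).
  by case: (z == v); case: (z == p); case: (z == q); case: (z == s).
case: ngoal; exists K, (p |: W), v, q, s; split.
- exact: same_deg_trans dK.
- split; first by rewrite cardsU1 pW sh.1.
  by rewrite vertsK cardsU1 vS sh.2 addSn.
- by rewrite vertsK subUset sub1set vU.
move=> y z /and4P[yz]; rewrite vertsK => yS zS yzW; apply: core => //.
have inS z' : z' \in S -> (z' == v) = false.
  by move=> z'S; apply/negbTE; apply: contraNneq vS => <-.
have vW : (v \in W) = false.
  by apply/negbTE; apply: contra vS; apply: (subsetP (sub_verts _ _ _ _)).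
have nvs : ~~ [|| v \in p |: W, s \in p |: W | upair v s v q].
  rewrite !in_setU1 vW (negbTE sW) (negbTE sp) /upair (negbTE sq) [v == p]eq_sym (inS p) //.
  by rewrite (inS s) // !andbF.
apply: contraTN yzW => /orP[] /andP[/eqP-> /eqP->] //.
by rewrite orbCA upairC.
Qed.

Lemma exists_goal :
    (exists H W a b c, config H W a b c) -> goal.
Proof.
case=> H0 [W0 [a0 [b0 [c0 cfg0]]]].
pose T := (sgraph V * {set V} * (V * V * V))%type.
pose Q (r : T) := config r.1.1 r.1.2 r.2.1.1 r.2.1.2 r.2.2.
pose m (r : T) := missing r.1.1 r.1.2 r.2.1.1 r.2.1.2 r.2.2.
pose B := (k + 5) * #|V| + #|V|.
have mB (r : T) : m r <= B.
  by rewrite /m /missing leq_add ?leq_mul2l ?max_card ?orbT.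
have [||[[H W] [[a b] c]] cfg min] := @exists_maximal T Q (fun r => B - m r) B (H0, W0, (a0, b0, c0)).
- exact: cfg0.
- by move=> t _; apply: leq_subr.
apply: (goal_of_minimal cfg) => H' W' a' b' c' cfg'.
have := min (H', W', (a', b', c')) cfg'; have := mB (H', W', (a', b', c')).
have := mB (H, W, (a, b, c)); rewrite /m /=.
by move: (missing _ _ _ _ _) (missing _ _ _ _ _) (B) => m1 m2 B0; clear; lia.
Qed.

End LargeDegree.

(** * The upper bound *)

Section Realization.
Variable V : finType.
Implicit Types (G H : sgraph V) (a b c s t u v w x y z : V) (U W : {set V}).

Lemma sum_isolate G v : \sum_w deg (isolate G v) w + 2 * deg G v = \sum_w deg G w.
Proof.
rewrite (bigD1 v) //= deg_isolate_self add0n [RHS](bigD1 v) //=.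
have -> : \sum_(w | w != v) deg G w =
          \sum_(w | w != v) deg (isolate G v) w + \sum_(w | w != v) nat_of_bool (G v w).
  by rewrite -big_split; apply: eq_bigr => w wv; rewrite (deg_isolate G wv) adj_sym.
have -> : \sum_(w | w != v) nat_of_bool (G v w) = deg G v.
  rewrite /deg -sum1_card big_mkcond [RHS]big_mkcond; apply: eq_bigr => w _.
  by rewrite inE; have [->|_] := eqVneq w v; rewrite ?adj_irr //=; case: (G v w).
by move: (deg G v) (\sum_(w | _) _); clear; lia.
Qed.

(** [threshold_realization] is applied on [k + 4] vertices of degree at least [5(k + 1)/3]. The
    degree sum provides that many, and each has room for about [2k/3] neighbours outside the wanted
    graph, enough for [dense]. *)
Lemma bounded_degree_case G U k :
    (forall v, v \notin U -> deg G v = 0) -> 4 * k + 20 <= #|U| ->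
    k.+1 * (2 * #|U|) + 4 <= \sum_w deg G w + k.+1 * k.+2 ->
    (forall v, deg G v <= 2 * k + 4) ->
  exists H W a b c,
    [/\ same_deg G H, shape k.+1 W a b c, verts W a b c \subset U & has_target H W a b c].
Proof.
move=> iso largeU largeS degD.
pose T := [set v | 5 * k.+1 <= 3 * deg G v].
have TU : T \subset U.
  by apply/subsetP=> v; rewrite inE; apply: contraTT => /iso->; rewrite muln0 -ltnNge.
have cT : k + 4 <= #|T|.
  rewrite leqNgt; apply/negP=> lt.
  have : 3 * \sum_w deg G w <= #|T| * (6 * k + 12) + (#|U| - #|T|) * (5 * k + 4).
    have -> : #|U| - #|T| = #|U :\: T| by rewrite cardsD (setIidPr TU).
    rewrite -!sum_if_const -big_split big_distrr; apply: leq_sum => w _ /=.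
    rewrite in_setD [in X in _ + X]/=; have [wU|/iso->] := boolP (w \in U); last by rewrite muln0.
    have := degD w; rewrite andbT; have [wT|] := boolP (w \in T).
      by move: (deg G w); clear; lia.
    by rewrite inE -ltnNge; move: (deg G w); clear; lia.
  move: lt largeS largeU; have := subset_leq_card TU.
  by move: (\sum_w _) #|U| #|T|; clear; nia.
(* For [k = 0] membership in [T] only ensures degree 2, while the single vertex of the clique needs
   3; so a vertex of maximum degree is put there. *)
have [v deg3 vmax] : exists2 v, 2 < deg G v & forall w, deg G w <= deg G v.
  have /card_gt0P[v0 _] : 0 < #|T| by apply: leq_trans cT; rewrite addnS.
  exists [arg max_(v > v0) deg G v]; case: arg_maxnP => // v _ vmax; last by move=> w; apply: vmax.
  rewrite ltnNge; apply/negP=> le2.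
  have : \sum_w deg G w <= #|U| * 2.
    rewrite -sum_if_const; apply: leq_sum => w _.
    have [wU|/iso->//] := boolP (w \in U); rewrite mul1n.
    exact: leq_trans (vmax w _) le2.
  move: largeS largeU; move: (\sum_w _) #|U|; clear; nia.
have vT : v \in T.
  have /card_gt0P[v0] : 0 < #|T| by apply: leq_trans cT; rewrite addnS.
  by rewrite !inE => /leq_trans; apply; rewrite leq_mul2l vmax.
have [|W [a [b [c [sh sT]]]]] := @pick_shape V k (T :\ v).
  by have := cT; have := cardsD1 v T; rewrite vT; move: #|T| #|_|; clear; lia.
have vv : v \notin verts W a b c by apply/negP=> /(subsetP sT); rewrite !inE eqxx.
have sh' := shape_cons vv sh.
have sT' : verts (v |: W) a b c \subset T.
  by rewrite verts_cons subUset sub1set vT (subset_trans sT) // subsetDl.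
(* For positive [k], this is the largest value that the degrees in [T] guarantee at a vertex of the
   clique, whose wanted degree is [k + 3]. *)
have [xi [xi0 xi_lo xi_hi]] : exists xi,
    [/\ 0 < xi, 2 * k - 1 <= 3 * xi & 3 * xi <= maxn 3 (2 * k + 1)].
  by exists (maxn 1 ((2 * k + 1) %/ 3)); clear; split; lia.
pose P := target (v |: W) a b c.
have room x w : P x w -> #|[set y | P x y]| + xi <= (deg G x).+1.
  move=> /and4P[_ xS _ _]; have := deg_target x sh'; rewrite -/P !in_set1.
  have := subsetP sT' x xS; rewrite inE.
  have /shapeP[cW /and5P[ab ac bc aW /andP[bW cW']]] := sh'.
  have [xW|xW] := boolP (x \in v |: W).
    have ne y : y \notin v |: W -> (x == y) = false.
      by move=> yW; apply/negbTE; apply: contraNneq yW => <-.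
    rewrite !ne //; case: (posnP k) => [k0|kpos].
      have W0 : W = set0 by apply/eqP; rewrite -cards_eq0 sh.1 k0.
      move: xW deg3; rewrite W0 setU0 inE => /eqP->.
      by move: xi_hi; rewrite k0; move: (deg G v) #|_| (xi); clear; lia.
    by move: xi_hi kpos; move: (deg G x) #|_| (xi); clear; lia.
  have lt1 : (x == a) + (x == b) + (x == c) <= 1.
    have [->|_] := eqVneq x a; first by rewrite (negbTE ab) (negbTE ac).
    by have [->|_] := eqVneq x b; rewrite ?(negbTE bc) //; case: (x == c).
  have : (x == a) * k.+2 + (x == b) * k.+2 + (x == c) * k.+1 <= k.+2.
    by move: lt1; case: (x == a); case: (x == b); case: (x == c); clear; lia.
  by move: xi_hi; move: (deg G x) #|_| (xi); clear; lia.
have [|||||||H dH FH] := @threshold_realization V P (2 * k + 4) xi _ _ _ _ G.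
- exact: target_sym.
- exact: target_irr.
- exact: target_threshold.
- exact: xi0.
- exact: degD.
- exact: room.
- have := sum_deg_target sh'; rewrite -/P; move: largeS largeU xi_lo xi0 xi_hi.
  move: (\sum_w _) (\sum_v _) #|U| (xi); clear=> S Q n x h1 h2 h3 h4 h5 h6.
  have gap : 2 * k * k + 6 < x * (2 * (2 * k + 4) + 1 - x) + 2 * k.
    have [hk|[hk|hk]] : k = 0 \/ k = 1 \/ 2 <= k by lia.
    - by have -> : x = 1; [lia | rewrite hk].
    - by have -> : x = 1; [lia | rewrite hk].
    have -> : 2 * (2 * k + 4) + 1 - x = 4 * k + 9 - x by lia.
    have [z ez] : exists z : nat, 4 * k + 9 = x + z by exists (4 * k + 9 - x); lia.
    have -> : 4 * k + 9 - x = z by lia.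
    have lo : (2 * k - 1) * (10 * k + 26) <= (3 * x) * (3 * z) by apply: leq_mul; lia.
    have [l kl] : exists l, k = l + 2 by exists (k - 2); lia.
    have e1 : 2 * k - 1 = 2 * l + 3 by lia.
    by move: lo; rewrite e1 kl mulnACA; move: (x * z) => p; clear; lia.
  have lo : k.+1 * (2 * (4 * k + 20)) <= k.+1 * (2 * n) by rewrite leq_mul2l leq_mul2l h2 !orbT.
  by move: gap h1 h4 h5 h6 lo; move: (x * _) (k.+1 * (2 * n)); clear; lia.
exists H, (v |: W), a, b, c; split=> //; first exact: subset_trans sT' TU.
Qed.

(** With [k = r - 2] and [n = #|U|], the degree sum is required to reach [(r-1)(2n-r)-2(n-r)+2],
    written without subtraction. The set [U] shrinks in the induction while the type stays. *)
Theorem realization_with_target k G U :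
    (forall v, v \notin U -> deg G v = 0) -> 4 * k + 16 <= #|U| ->
    k * (2 * #|U|) + 4 <= \sum_w deg G w + k * k.+1 ->
  exists H W a b c,
    [/\ same_deg G H, shape k W a b c, verts W a b c \subset U & has_target H W a b c].
Proof.
elim: k G U => [|k IHk] G U iso largeU largeS.
  have [a [b ab]] : exists a b, G a b.
    apply: contrapT => nex; move: largeS; rewrite big1 // => a _; apply/eqP.
    rewrite cards_eq0; apply/eqP/setP=> b; rewrite !inE; apply/negbTE/negP=> ab.
    by apply: nex; exists a, b.
  have inU x y : G x y -> x \in U.
    move=> xy; apply: contraT => /iso/eqP; rewrite cards_eq0 => /eqP/setP/(_ y).
    by rewrite !inE xy.
  have ba : G b a by rewrite adj_sym.
  have [c cU] : exists c, c \in U :\ a :\ b.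
    apply/card_gt0P; have := cardsD1 a U; have := cardsD1 b (U :\ a).
    by move: largeU; move: #|_| #|_| #|_|; clear; lia.
  move: cU; rewrite !inE => /and3P[cb ca cU].
  exists G, set0, a, b, c; split=> //.
  - apply/shapeP; rewrite cards0 !inE (adj_neq ab) ![_ == c]eq_sym cb ca; by [].
  - apply/subsetP=> z; rewrite in_verts inE orbF.
    by case/or3P=> /eqP->; rewrite // ?(inU _ _ ab) ?(inU _ _ ba).
  - move=> x y /and4P[_ _ _]; rewrite !inE /=.
    by case/orP=> /andP[/eqP-> /eqP->].
have [bounded|] := boolP [forall v, deg G v <= 2 * k + 4].
  apply: bounded_degree_case iso _ largeS (forallP bounded).
  by move: largeU; clear; lia.
rewrite negb_forall => /existsP[v]; rewrite -ltnNge => degv.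
have [H0 dH0 top] := top_neighbours G v.
have vU : v \in U by apply: contraLR degv => /iso->.
have cU := cardsD1 v U; rewrite vU in cU.
have degvU : deg H0 v <= #|U :\ v|.
  apply/subset_leq_card/subsetP=> w; rewrite !inE => vw.
  rewrite eq_sym (adj_neq vw); apply: contraT => /iso; rewrite -dH0 => /eqP.
  by rewrite cards_eq0 => /eqP/setP/(_ v); rewrite !inE adj_sym vw.
have [||| K [W [a [b [c [dK sh sU FK]]]]]] := IHk (isolate H0 v) (U :\ v).
- move=> w; rewrite !inE negb_and negbK => /orP[/eqP->|/iso]; first exact: deg_isolate_self.
  have [->|wv] := eqVneq w v; first by rewrite deg_isolate_self.
  by rewrite -dH0 (deg_isolate H0 wv) => /eqP; rewrite addn_eq0 => /andP[/eqP].
- by move: largeU cU; move: #|U| #|_|; clear; lia.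
(* Lowering [k] and [#|U|] by one lowers the required sum by exactly [2(#|U| - 1)], and the deletion
   of [v] costs at most that. *)
- move: (sum_isolate H0 v) largeS cU degvU.
  have -> : \sum_w deg H0 w = \sum_w deg G w by apply: eq_bigr.
  move: (\sum_w _) (\sum_w _) (deg H0 v) #|U| #|U :\ v|; clear=> S1 S2 d n m.
  by move=> <- + en; rewrite en /=; lia.
have vN : v \notin nbr H0 v by rewrite inE adj_irr.
have vS : v \notin verts W a b c by apply/negP=> /(subsetP sU); rewrite !inE eqxx.
apply: (@exists_goal V G U v k) => //.
- by move: degv; clear; lia.
- by move: largeU; clear; lia.
exists (star_at K vN), W, a, b, c; split=> //.
- by apply: same_deg_trans dH0 _; apply: same_deg_star.
- by move=> p q; rewrite !star_self !inE; apply: top.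
move=> x y xy; move: (xy) => /and4P[_ xS yS _].
by rewrite star_out ?FK //; [apply: contraNneq vS => <- | apply: contraNneq vS => <-].
Qed.

End Realization.

(** * The extremal sequence *)

Lemma card_ord_below j n : j <= n -> #|[set y : 'I_n | y < j]| = j.
Proof.
move=> jn; rewrite -sum1dep_card -(big_ord_widen n (fun=> 1)) //.
by rewrite sum1_card card_ord.
Qed.

Section Extremal.
Variables k n : nat.

Let F : sgraph 'I_k.+3 := complete_minus k.+3 (path_graph 2).

Lemma complete_minus_path x y :
  F x y = (x != y) && ~~ [&& x < 3, y < 3 & (x.+1 == y) || (y.+1 == x)].
Proof.
congr (_ && ~~ _); apply/existsP/and3P => [[i /existsP[j /and3P[/eqP ix /eqP jy]]]|[x3 y3 xy]].
  by move=> ij; rewrite -ix -jy !ltn_ord.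
exists (Ordinal x3); apply/existsP; exists (Ordinal y3).
by rewrite /= !eqxx.
Qed.

Lemma contains_target (V : finType) (G : sgraph V) (W : {set V}) a b c :
  shape k W a b c -> has_target G W a b c -> contains F G.
Proof.
move=> sh FG; have /shapeP[cW /and5P[ab ac bc aW /andP[bW cW']]] := sh.
(* The deleted path runs through 0, 1, 2: its middle vertex is [c], and its ends [a] and [b] remain
   adjacent. *)
pose s := [:: a; c; b] ++ enum W.
have us : uniq s.
  rewrite cat_uniq enum_uniq andbT; apply/andP; split.
    by rewrite /= !inE negb_or ac ab [c == b]eq_sym bc.
  by apply/hasPn=> z; rewrite mem_enum !inE => zW; rewrite !negb_or;
    apply/and3P; split; apply: contraTneq zW => ->.
have ss : size s = k.+3 by rewrite size_cat /= -cardE cW.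
have vs z : z \in s -> z \in verts W a b c.
  by rewrite in_verts mem_cat mem_enum !inE; case: (z == a); case: (z == b); case: (z == c).
pose f (i : 'I_k.+3) := nth a s i.
have fs i : f i \in s by rewrite mem_nth ?ss.
have finj : injective f.
  by move=> i j /eqP; rewrite nth_uniq ?ss // => /eqP /val_inj.
have fW (i : 'I_k.+3) : 2 < i -> f i \in W.
  move=> i3; rewrite -mem_enum /f nth_cat /= ltnNge i3 /= mem_nth //.
  by rewrite -cardE cW; have := ltn_ord i; move: i3; clear; lia.
exists f => // x y; rewrite complete_minus_path => /andP[xy nxy].
apply: FG; apply/and4P; split; [by rewrite (inj_eq finj) | exact: vs | exact: vs |].
have [/fW->//|x3] := ltnP 2 x; have [/fW->|y3] := ltnP 2 y; first by rewrite orbT.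
have : (x : nat) != y by [].
move: nxy; rewrite /upair /f; move: x3 y3; clear.
by case: x y => -[|[|[|x]]] /= ? [[|[|[|y]]]] //= ? _ _ _; rewrite !eqxx ?orbT.
Qed.

Lemma sigma_bound_target l :
  4 * k + 16 <= n -> ~~ odd l -> k * (2 * n) + 4 <= l + k * k.+1 -> sigma_bound F n l.
Proof.
move=> largen evenl largel; split=> // s [_ [G Gs]] ls.
have sG : \sum_v deg G v = sumn s.
  by rewrite -(perm_sumn Gs) sumnE big_map big_enum.
have [v||| H [W [a [b [c [dH sh _ FH]]]]]] := @realization_with_target _ k G setT.
- by rewrite inE.
- by rewrite cardsT card_ord.
- by rewrite cardsT card_ord sG; apply: leq_trans largel _; rewrite leq_add2r.
exists H; last exact: contains_target sh FH.
by rewrite /realization (eq_image (frefl _) dH).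
Qed.

(* The join of the complete graph on the vertices below [j] with a cycle through
   the other ones. *)
Section Wheel.
Variable j : nat.
Hypothesis jn : j + 3 < n.

Let le_jn : j <= n.
Proof. by move: jn; clear; lia. Qed.

Definition wheel_rel : rel 'I_n := fun x y =>
  (x != y) && [|| x < j, y < j, x.+1 == y, y.+1 == x,
                  (x == j :> nat) && (y.+1 == n) | (y == j :> nat) && (x.+1 == n)].

Fact wheel_sym : symmetric wheel_rel.
Proof.
move=> x y; rewrite /wheel_rel eq_sym; congr (_ && _); rewrite orbCA; do 2!congr (_ || _).
by rewrite orbCA; do 2!congr (_ || _); rewrite orbC.
Qed.

Fact wheel_irr : irreflexive wheel_rel.
Proof. by move=> x; rewrite /wheel_rel eqxx. Qed.

Definition wheel := SGraph wheel_sym wheel_irr.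

Definition wheel_deg i := if i < j then n.-1 else j.+2.

Lemma deg_wheel x : deg wheel x = wheel_deg x.
Proof.
rewrite /wheel_deg; case: ifPn => xj.
  rewrite (_ : n.-1 = #|[set~ x]|); last by rewrite cardsC1 card_ord.
  by apply: eq_card => y; rewrite !inE /= /wheel_rel xj andbT eq_sym.
(* Successor and predecessor of [x] on the cycle, on which [n.-1] is followed by [j]. *)
have succ_lt : (if x.+1 == n then j else x.+1) < n.
  by case: eqP (ltn_ord x) => // [_ _|]; move: jn; clear; lia.
have pred_lt : (if x == j :> nat then n.-1 else x.-1) < n.
  by have := ltn_ord x; case: ifP => _; move: jn; clear; lia.
pose su := Ordinal succ_lt; pose pr := Ordinal pred_lt.
have supr : su != pr.
  rewrite -val_eqE /=; have := ltn_ord x; move: xj jn; clear.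
  by case: (x.+1 =P n); case: (val x =P j) => /=; lia.
have eN : [set y | wheel x y] = [set y : 'I_n | y < j] :|: [set su; pr].
  apply/setP=> y; rewrite !inE /= /wheel_rel (negbTE xj) -!val_eqE /=.
  have := ltn_ord x; have := ltn_ord y; move: xj jn; clear.
  by move: (val x) (val y) => {}x {}y; case: (x.+1 =P n); case: (x =P j) => /=; lia.
rewrite /deg eN cardsU (card_ord_below le_jn) cards2 supr (_ : _ :&: _ = set0) ?cards0 ?subn0 ?addn2 //.
apply/setP=> y; rewrite !inE; apply/negbTE/negP=> /andP[yj].
rewrite -!val_eqE /=; have := ltn_ord x; move: xj jn yj; clear.
by move: (val x) (val y) => {}x {}y; case: (x.+1 =P n); case: (x =P j) => /=; lia.
Qed.

Definition wheel_seq : n.-tuple nat := [tuple wheel_deg i | i < n].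

Lemma wheel_seqE : wheel_seq = [seq wheel_deg i | i <- iota 0 n] :> seq nat.
Proof. by rewrite /= -val_enum_ord -map_comp. Qed.

Lemma graphic_wheel : graphic wheel_seq.
Proof.
split; last first.
  by exists wheel; rewrite /realization (eq_image (frefl _) deg_wheel) perm_refl.
rewrite wheel_seqE; apply: (homo_sorted (e := leq)); last exact: iota_sorted.
by move=> x y xy; rewrite /= /wheel_deg; move: jn xy; clear; do 2!case: ifP; lia.
Qed.

Lemma sum_wheel : sumn wheel_seq = j * n.-1 + (n - j) * j.+2.
Proof.
rewrite wheel_seqE sumnE; have -> : iota 0 n = index_iota 0 n by rewrite /index_iota subn0.
rewrite big_map (@big_cat_nat _ _ _ j) //=.
rewrite (eq_big_nat _ _ (F2 := fun _ => n.-1)) => [|i /andP[_ ij]]; last by rewrite /wheel_deg ij.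
rewrite [X in _ + X](eq_big_nat _ _ (F2 := fun _ => j.+2)) => [|i /andP[ji _]].
  by rewrite !sum_nat_const_nat subn0.
by rewrite /wheel_deg ltnNge ji.
Qed.

(** The count depends only on the degree sequence, so it can be made in the wheel, where [jn] gives
    [j.+2 < n.-1]. *)
Lemma card_large_wheel (G : sgraph 'I_n) :
  realization G wheel_seq -> #|[set v | j.+2 < deg G v]| = j.
Proof.
move=> Gs; rewrite -[RHS](card_ord_below le_jn).
have cnt (f : 'I_n -> nat) : #|[set v | j.+2 < f v]| = count (ltn j.+2) [seq f v | v : 'I_n].
  by rewrite -sum1dep_card -sum1_count big_map big_enum_cond; apply: eq_bigl.
rewrite (cnt (deg G)) (seq.permP (Gs : perm_eq _ _)) -[LHS](cnt (fun i => wheel_deg i)).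
apply: eq_card => v; rewrite !inE /wheel_deg; move: jn; clear.
by case: ifP; lia.
Qed.

(** The [k] vertices off the deleted path have degree [k + 2] in [F], so their images have degree
    above [j + 2]; only [j] vertices do. *)
Lemma wheel_not_potentially : j < k -> ~ potentially F wheel_seq.
Proof.
move=> jk [G Gs [f finj Ff]].
have core (i : 'I_k.+3) : 2 < i -> k.+2 <= deg G (f i).
  move=> i3; have -> : k.+2 = #|f @: [set~ i]| by rewrite card_imset // cardsC1 card_ord.
  apply/subset_leq_card/subsetP=> _ /imsetP[x xi ->]; rewrite !inE in xi *.
  by apply: Ff; rewrite complete_minus_path eq_sym xi ltnNge i3.
have : #|[set i : 'I_k.+3 | 2 < i]| <= #|[set v | j.+2 < deg G v]|.
  rewrite -(card_imset _ finj); apply/subset_leq_card/subsetP=> _ /imsetP[i i3 ->].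
  by rewrite inE in i3; rewrite inE (leq_trans _ (core i i3)) // !ltnS.
rewrite (card_large_wheel Gs) leqNgt => /negP; apply; apply: leq_trans jk _.
have := cardsC [set i : 'I_k.+3 | i < 3]; rewrite card_ord card_ord_below //.
rewrite (_ : ~: _ = [set i : 'I_k.+3 | 2 < i]); first by move: #|_|; clear; lia.
by apply/setP=> i; rewrite !inE ltnNge negbK.
Qed.

End Wheel.

Lemma sigma_target : 0 < k -> 4 * k + 16 <= n -> sigma F n + k * k.+1 = k * (2 * n) + 4.
Proof.
move=> kpos largen; rewrite /sigma; case: ex_minnP => m /asboolP[evenm boundm] minm.
(* [l] is the claimed value, given by an equation to avoid truncated subtraction. *)
have [l el] : exists l, l + k * k.+1 = k * (2 * n) + 4.
  exists (k * (2 * n) + 4 - k * k.+1); rewrite subnK //.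
  by apply: leq_trans (leq_addr _ _); rewrite leq_mul2l; move: largen; clear; lia.
have evenl : ~~ odd l.
  have := congr1 odd el; rewrite !oddD !oddM /= !andbF /=.
  by case: (odd k); rewrite ?andbF ?addbF => /= ->.
have ml : m <= l by apply/minm/asboolP/sigma_bound_target; rewrite ?el.
suff lm : l <= m by rewrite (_ : m = l) //; apply/eqP; rewrite eqn_leq ml.
rewrite leqNgt; apply/negP=> m_lt.
have jn : k.-1 + 3 < n by move: largen; clear; lia.
apply: (@wheel_not_potentially k.-1 jn); first by rewrite prednK.
apply: boundm; first exact: graphic_wheel.
(* For [j = k - 1] this sum is exactly [l - 2], and by parity [m < l] means [m + 2 <= l]. *)
rewrite sum_wheel //.
have ml2 : m.+2 <= l.
  rewrite ltn_neqAle m_lt andbT; apply: contraNneq evenm => em.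
  by move: evenl; rewrite -em /= negbK.
move: kpos el largen ml2; clear; case: k => [//|k' _] /= el largen ml2.
have [p np] : exists p, n = k' + p.+1 by exists (n - k'.+1); lia.
by move: el ml2; rewrite np addKn [k' + _]addnS /=; clear; lia.
Qed.

End Extremal.

Local Open Scope ring_scope.

Theorem theorem1p1 (r n : nat) (hr : (3 <= r)%N) (hn : (4 * r + 8 <= n)%N) :
  (sigma (complete_minus r.+1 (path_graph 2)) n)%:Z =
    (r%:Z - 1) * (2 * n%:Z - r%:Z) - 2 * (n%:Z - r%:Z) + 2.
Proof.
have [k rk] : exists k, r = k.+2 by exists r.-2; lia.
move: hr hn; rewrite rk => hr hn.
have := @sigma_target k n; move: (sigma _ n) => s hs.
have {}hs : (s + k * k.+1 = k * (2 * n) + 4)%N by apply: hs; lia.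
lia.
Qed.
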